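(* Let $s,n,m$ be positive integers with $\gcd(s,n)=1$. Then the knot $$Z^{st}(s,n,m):=\lim_{a\to\infty}Z(s,an,am)^{(a)}$$ is well-defined: there is an integer $\tilde a$ such that for all integers $a\ge\tilde a$ we have $$Z(s,\tilde a n,\tilde a m)^{(\tilde a)}=Z(s,an,am)^{(a)}.$$
   Context: Let $g(t)=2\,|t-\lfloor t\rfloor-\tfrac12|$. Knots $Z(s,an,am)^{(a)}$. Let $a\ge1$ be an integer with $an\ge 2s+1$ and put $\beta=2\pi/a$. Consider in $\mathbb C$ the polygonal path $P:[0,1]\to\mathbb C$, parametrized proportionally to arclength, through the points $P(k/n)=e^{iks\beta/n}$, $k=0,\dots,n$ (consecutive points joined by chords of the unit circle). Since $an\ge 2s+1$, the path avoids $0$; write $P(t)=r(t)e^{i\theta(t)}$ with $\theta$ continuous, $\theta(0)=0$, so that $\theta(1)=s\beta$. For a phase $\phi\in[0,1]$ the map $$t\mapsto\bigl(r(t)e^{2\pi i\theta(t)/\beta},\;g(mt+\phi)\bigr)\in\mathbb C\times\mathbb R=\mathbb R^3,\qquad t\in[0,1],$$ is a closed curve; this is the billiard curve in a slice of angle $2\pi/a$ of the cylinder $D^2\times[0,1]$ whose radial faces are identified. $Z(s,an,am)^{(a)}$ denotes the knot given by this curve for any phase $\phi$ for which it has no self-intersections; different such phases give the same knot up to mirror image. For $a=1$ and $n\ge 2s+1$ this is the cylinder knot $Z(s,n,m)$ (the billiard knot in the cylinder $D^2\times[0,1]$ whose projection has $s$ rotations and $n$ reflections and which has $m$ maxima),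 and for $a$ coprime to $s$ it is the factor knot of the cylinder knot $Z(s,an,am)$ under its cyclic symmetry of order $a$ (rotation about the cylinder axis). Equality of knots: $K_1=K_2$ means that $K_1$ is equivalent to one of $K_2,-K_2,K_2^*,-K_2^*$, where $-K$ is $K$ with reversed orientation and $K^*$ is the mirror image. *)

(* Defs.v *)
From mathcomp Require Import all_boot all_order all_algebra.
From mathcomp Require Import all_classical all_reals all_analysis.

Set Implicit Arguments.
Unset Strict Implicit.
Unset Printing Implicit Defensive.

Import Order.TTheory GRing.Theory Num.Theory.
Import numFieldNormedType.Exports.

Local Open Scope classical_set_scope.
Local Open Scope ring_scope.

Section Knots.
Variable R : realType.

(* The point (x + iy, z) of C x R is encoded as (x, y, z) : R * R * R.
   An oriented closed curve in space is a 1-periodic function on R, i.e. a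
   function on the circle R/Z; the orientation is that of increasing t. *)
Definition is_knot (K : R -> R * R * R) : Prop :=
  [/\ continuous K,
      forall t, K (t + 1) = K t &
      {in `[0, 1[ &, injective K}].

Definition homeomorphism (T : topologicalType) (f : T -> T) : Prop :=
  continuous f /\
  exists g : T -> T, [/\ continuous g, cancel f g & cancel g f].

Definition ambient_isotopy (H : R -> R * R * R -> R * R * R) : Prop :=
  [/\ {within [set p : R * (R * R * R) | p.1 \in `[0, 1]],
         continuous (fun p => H p.1 p.2)},
      forall x, H 0 x = x &
      forall t, t \in `[0, 1] -> homeomorphism (H t)].

(* Lifts to R of the orientation-preserving homeomorphisms of R/Z. *)
Definition circle_reparam (h : R -> R) : Prop :=
  [/\ continuous h, {homo h : x y / x < y} & forall t, h (t + 1) = h t + 1].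

Definition knot_equivalent (K1 K2 : R -> R * R * R) : Prop :=
  exists H h, [/\ ambient_isotopy H, circle_reparam h &
    forall t, H 1 (K1 t) = K2 (h t)].

Definition reverse (K : R -> R * R * R) : R -> R * R * R := fun t => K (- t).

Definition mirror (K : R -> R * R * R) : R -> R * R * R :=
  fun t => let: (x, y, z) := K t in (x, y, - z).

(* Equality of knots, up to orientation and mirror image. *)
Definition knot_eq (K1 K2 : R -> R * R * R) : Prop :=
  [\/ knot_equivalent K1 K2,
      knot_equivalent K1 (reverse K2),
      knot_equivalent K1 (mirror K2) |
      knot_equivalent K1 (reverse (mirror K2))].

Definition zigzag (t : R) : R := 2 * `|t - (Num.floor t)%:~R - 1 / 2|.

Definition slice_angle (a : nat) : R := 2 * pi / a%:R.

Definition path_vertex (s n a : nat) (k : int) : R * R :=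
  let alpha := k%:~R * s%:R * slice_angle a / n%:R in (cos alpha, sin alpha).

(* Piecewise linear interpolation of the vertices at the times k / n. This is
   the parametrization proportional to arclength because all the chords have
   the same length. *)
Definition chord_path (s n a : nat) (t : R) : R * R :=
  let k := Num.floor (n%:R * t) in
  let u := n%:R * t - k%:~R in
  let v := path_vertex s n a k in
  let w := path_vertex s n a (k + 1) in
  ((1 - u) * v.1 + u * w.1, (1 - u) * v.2 + u * w.2).

Definition polar_form (P : R -> R * R) (r theta : R -> R) : Prop :=
  [/\ {within `[0, 1], continuous theta}, theta 0 = 0 &
      forall t, t \in `[0, 1] ->
        0 < r t /\ P t = (r t * cos (theta t), r t * sin (theta t))].

(* K is the 1-periodic extension of the billiard curve of phase phi in the
   slice of angle 2 pi / a with identified radial faces. *)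
Definition slice_curve (s n m a : nat) (phi : R) (K : R -> R * R * R) : Prop :=
  (forall t, K (t + 1) = K t) /\
  exists r theta : R -> R,
    polar_form (chord_path s n a) r theta /\
    forall t, t \in `[0, 1] ->
      let omega := 2 * pi * theta t / slice_angle a in
      K t = (r t * cos omega, r t * sin omega, zigzag (m%:R * t + phi)).

(* K represents the knot Z(s, a n, a m)^(a): the phase is any one for which
   the curve has no self-intersections. *)
Definition factor_knot (s n m a : nat) (K : R -> R * R * R) : Prop :=
  [/\ (1 <= a)%N, (2 * s + 1 <= a * n)%N, is_knot K &
      exists2 phi : R, phi \in `[0, 1] & slice_curve s n m a phi K].

End Knots.

(* Main.v *)
Require Import Defs.
From mathcomp Require Import all_boot all_order all_algebra.
From mathcomp Require Import all_classical all_reals all_analysis.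
From mathcomp Require Import ring lra zify.

(** The curve is followed by its edge coordinate x: the integer part of x
    counts the edges of the chord path that are already completed, and its
    fractional part is the share of the turning angle of the current edge that
    is already swept. In this coordinate the azimuth is 2 pi s x / n, the
    distance to the axis is an increasing function of g(x), where g is the
    zigzag function, and only the time T(x)/n at which x is reached and that
    increasing function depend on the slice, through half the angle
    e = pi s / (n a) under which an edge is seen from the axis.

    Consequently the crossings of the projection do not depend on a. The points
    x and y have the same projection iff s (x - y) / n is an integer j and
    x - y or x + y is an integer; as s and n are coprime, either x = y modulo n
    or x + y is an integer k (planar_crossing). Since T is odd and commutes with
    integer translations, T(x) + T(y) = k at a crossing, and the heights
    g(m T(x)/n + phi) and g(m T(y)/n + phi) agree only if m k/n + 2 phi is an
    integer, which is excluded when the curve of phase phi is embedded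
    (knot_generic), or if m (T(x) - T(y))/n is an integer. For large a the
    latter number is close to m j/s. If m j/s is not an integer, nothing happens
    for large a. If it is an integer, the limit curve for infinite a does
    intersect itself, but T(x) - x has a sign that does not depend on a, because
    the tangent is strictly convex on [0, pi/2[ (edge_time_shift_sign): all
    curves with large a pass the intersection on the same side. The same
    argument applies to every convex combination of two time functions
    (strand_inj, mix_admissible), so that the height functions of two slices can
    be deformed into each other while the curve stays embedded.

    This deformation is used only to see that both curves have the same upper
    strand at every crossing. The ambient isotopy is then built in one step: by
    compactness the change of height satisfies a one-sided Lipschitz condition
    (stretch_of_crossings), and an extension by an infimum in the style of
    McShane gives a homeomorphism of space that moves points only vertically
    and is bilipschitz in the vertical direction (vertical_isotopy). A second
    isotopy, explicit with an explicit inverse, changes the distances to the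
    axis (radial_isotopy).

    The same isotopies serve for two phases between which no critical phase
    lies. The critical phases are the multiples of 1/(2n') with
    n' = n / gcd(m, n). Rotating the curve about the axis by a multiple of its
    symmetry angle shifts the phase by any multiple of 1/n', and the reflection
    in a vertical plane together with the reversal of the curve changes phi into
    - phi; hence any two phases that are not critical give the same knot up to
    orientation and mirror image (knot_eq_billiard). *)

Set Implicit Arguments.
Unset Strict Implicit.
Unset Printing Implicit Defensive.

Import Order.TTheory GRing.Theory Num.Theory.
Import numFieldNormedType.Exports.

Local Open Scope classical_set_scope.
Local Open Scope ring_scope.

(** * Ambient isotopies that move points vertically *)

Section Isotopies.
Variable R : realType.
Implicit Types (p q : R * R * R) (H : R -> R * R * R -> R * R * R).

Lemma knot_equivalent_trans (K1 K2 K3 : R -> R * R * R) :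
  knot_equivalent K1 K2 -> knot_equivalent K2 K3 -> knot_equivalent K1 K3.
Proof.
move=> [H [h [[Hc H0 Hh] [hc hm h1] HK]]] [H' [h' [[Hc' H0' Hh'] [hc' hm' h1'] HK']]].
exists (fun t x => H' t (H t x)), (h' \o h); split; last by move=> t /=; rewrite HK HK'.
- split.
  + apply/subspace_continuousP => -[t x] tI.
    move/subspace_continuousP/(_ (t, x) tI) : Hc => Hc.
    move/subspace_continuousP/(_ (t, H t x) tI) : Hc' => /= Hc'.
    have Hp : (p.1, H p.1 p.2) @[p --> within [set p : R * (R * R * R) | p.1 \in `[0, 1]]
        (nbhs (t, x))] --> (t, H t x).
      have H1 : p.1 @[p --> within [set p : R * (R * R * R) | p.1 \in `[0, 1]] (nbhs (t, x))] --> t.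
        by apply: cvg_within_filter; exact: cvg_fst.
      exact: (cvg_pair H1 Hc).
    move=> U /Hc'/Hp; rewrite /nbhs/=; rewrite /within/=; apply: filterS => -[t' x'] /= + tI'.
    by move/(_ tI'); apply.
  + by move=> x; rewrite H0 H0'.
  + move=> t tI; have [c [g [gc fg gf]]] := Hh t tI.
    have [c' [g' [gc' fg' gf']]] := Hh' t tI; split.
      by move=> x; apply: continuous_comp; [exact: c|exact: c'].
    exists (g \o g'); split.
    * by move=> x; apply: continuous_comp; [exact: gc'|exact: gc].
    * by move=> x /=; rewrite fg' fg.
    * by move=> x /=; rewrite gf gf'.
- split.
  + by move=> x; apply: continuous_comp; [exact: hc|exact: hc'].
  + by move=> x y xy /=; apply/hm'/hm.
  + by move=> t /=; rewrite h1 h1'.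
Qed.

Lemma cvg_bounded_by (T : topologicalType) (f g : T -> R) (x : T) :
  (forall y, `|f y - f x| <= g y) -> g y @[y --> x] --> 0 -> {for x, continuous f}.
Proof.
move=> fg g0; apply/cvgrPdist_lt => e e0.
move/cvgrPdist_lt : g0 => /(_ e e0); apply: filterS => y; rewrite sub0r normrN => ge.
by rewrite distrC (le_lt_trans (fg y))// (le_lt_trans (ler_norm _)).
Qed.

Lemma lipschitz_real_continuous (f : R -> R) (L : R) :
  (forall x y, `|f x - f y| <= L * `|x - y|) -> continuous f.
Proof.
move=> fL x; apply: (@cvg_bounded_by _ _ (fun y => L * `|y - x|)) => //.
rewrite -[X in _ --> X](mulr0 L) -[X in L * X](normr0 R) -(subrr x).
by apply: cvgMr; apply: cvg_norm; apply: cvgB; [exact: cvg_id|exact: cvg_cst].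
Qed.

Definition planar_gap p q : R := `|p.1.1 - q.1.1| + `|p.1.2 - q.1.2|.

Lemma continuous_gap q : continuous (fun p => planar_gap p q).
Proof.
move=> p; rewrite /planar_gap; apply: cvgD; apply: cvg_norm; apply: cvgB; try exact: cvg_cst.
  by apply: cvg_comp; [exact: cvg_fst|exact: cvg_fst].
by apply: cvg_comp; [exact: cvg_fst|exact: cvg_snd].
Qed.

Lemma coordinatewise_lipschitz_continuous (f : R * R * R -> R) (M L : R) :
  (forall p q, f p - f q <= M * planar_gap p q + L * `|p.2 - q.2|) -> continuous f.
Proof.
move=> fL p; apply: (@cvg_bounded_by _ _ (fun q => M * planar_gap q p + L * `|q.2 - p.2|)).
  move=> q; rewrite ler_norml lerNl opprB fL andbT.
  by apply: le_trans (fL p q) _; rewrite /planar_gap !(distrC (_ p.1)) (distrC p.2).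
have -> : 0 = M * planar_gap p p + L * `|p.2 - p.2| :> R.
  by rewrite /planar_gap !subrr normr0 !addr0 !mulr0 addr0.
apply: cvgD; apply: cvgMr.
  exact: continuous_gap.
by apply: cvg_norm; apply: cvgB; [exact: cvg_snd|exact: cvg_cst].
Qed.

(** An increasing bijection of the line with slopes between c and C is described
    by the one-sided bound G u - G v <= stretch c C (u - v). As stretch c C is
    sublinear, such bounds survive infima; this is what replaces the absolute
    value of the usual Lipschitz extension. *)
Definition stretch (c C u : R) : R := Num.max (c * u) (C * u).

Lemma stretch_le c C u v : c * u <= v -> C * u <= v -> stretch c C u <= v.
Proof. by move=> h1 h2; rewrite /stretch ge_max h1. Qed.

Lemma stretch_ub c C u : (c * u <= stretch c C u) * (C * u <= stretch c C u).
Proof. by rewrite /stretch !le_max !lexx orbT. Qed.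

Lemma stretchD c C u v : stretch c C (u + v) <= stretch c C u + stretch c C v.
Proof. by apply: stretch_le; rewrite mulrDr lerD// stretch_ub. Qed.

Lemma stretch_mix c C l u : 0 <= l <= 1 ->
  (1 - l) * u + l * stretch c C u = stretch (1 - l + l * c) (1 - l + l * C) u.
Proof.
by move=> /andP[l0 l1]; rewrite /stretch maxr_pMr// addr_maxr !mulrDl !mulrA.
Qed.

Lemma stretch_nneg c C u : c <= C -> 0 <= u -> stretch c C u = C * u.
Proof. by move=> cC u0; apply/max_idPr/ler_wpM2r. Qed.

Lemma stretch_npos c C u : c <= C -> u <= 0 -> stretch c C u = c * u.
Proof. by move=> cC u0; apply/max_idPl/ler_wnM2r. Qed.

Lemma stretch_le_norm c C u : 0 <= c -> c <= C -> stretch c C u <= C * `|u|.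
Proof.
move=> c0 cC; case: (leP 0 u) => u0; first by rewrite stretch_nneg// ger0_norm.
rewrite stretch_npos ?(ltW u0)// (@le_trans _ _ 0)//.
  by rewrite mulr_ge0_le0// ltW.
by rewrite mulr_ge0// (le_trans c0).
Qed.

Lemma planar_gap0 p q : p.1 = q.1 -> planar_gap p q = 0.
Proof. by rewrite /planar_gap => ->; rewrite !subrr normr0 addr0. Qed.

Lemma planar_gapC p q : planar_gap p q = planar_gap q p.
Proof. by rewrite /planar_gap !(distrC (_ p.1)). Qed.

Lemma planar_gap_tri q p r : planar_gap p r <= planar_gap p q + planar_gap q r.
Proof.
rewrite /planar_gap addrACA lerD//.
  exact: ler_distD.
exact: ler_distD.
Qed.

Definition stretching (c C M : R) (G : R * R * R -> R) :=
  forall p q, G p - G q <= stretch c C (p.2 - q.2) + M * planar_gap p q.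

Lemma stretching_continuous c C M G :
  0 < c -> c <= C -> stretching c C M G -> continuous G.
Proof.
move=> c0 cC GS; apply: (@coordinatewise_lipschitz_continuous _ M C) => p q.
by rewrite (le_trans (GS p q))// addrC lerD2l stretch_le_norm// ltW.
Qed.

Lemma continuous_triple (T : topologicalType) (f g h : T -> R) :
  continuous f -> continuous g -> continuous h -> continuous (fun t => (f t, g t, h t)).
Proof. by move=> cf cg ch t; exact: (cvg_pair (cvg_pair (cf t) (cg t)) (ch t)). Qed.

(** A slope at least c makes the values unbounded in both directions. *)
Lemma stretching_surj c C M G (x y w : R) :
  0 < c -> c <= C -> stretching c C M G -> exists z, G (x, y, z) = w.
Proof.
move=> c0 cC GS; set f := fun z => G (x, y, z).
have fL u v : u <= v -> c * (v - u) <= f v - f u.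
  move=> uv; have := GS (x, y, u) (x, y, v).
  rewrite planar_gap0// mulr0 addr0 stretch_npos//= ?subr_le0//.
  by rewrite -/(f u) -/(f v); lra.
have fc : continuous f.
  move=> z; apply: continuous_comp; last exact: (stretching_continuous c0 cC GS).
  by apply: continuous_triple => ?; [exact: cst_continuous|exact: cst_continuous|exact: cvg_id].
pose r := `|w - f 0| / c.
have r0 : 0 <= r by rewrite divr_ge0// ltW.
have cr : c * r = `|w - f 0| by rewrite mulrC divfK// gt_eqF.
have h1 := fL 0 r r0; have h2 := fL (- r) 0.
have {}h2 := h2 ltac:(lra).
have := ler_norm (w - f 0); have := ler_norm (- (w - f 0)); rewrite normrN => h3 h4.
have [z _ fz] : exists2 z, z \in `[- r, r] & f z = w.
  apply: IVT; [lra|by apply: continuous_subspaceT|].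
  by apply/andP; split; [rewrite ge_min|rewrite le_max]; apply/orP; [left|right]; lra.
by exists z.
Qed.

(** The vertical slope is at least c, so the inverse is again Lipschitz, hence
    continuous jointly in all coordinates. *)
Lemma stretching_homeo c C M G :
  0 < c -> c <= C -> 0 <= M -> stretching c C M G ->
  homeomorphism (fun p : R * R * R => (p.1, G p)).
Proof.
move=> c0 cC M0 GS; have Gc := stretching_continuous c0 cC GS.
have ex q : exists z, G (q.1.1, q.1.2, z) = q.2.
  exact: (stretching_surj _ _ _ c0 cC GS).
pose W q := projT1 (cid (ex q)).
have WE q : G (q.1, W q) = q.2.
  by rewrite /W; case: cid => z /= <-; rewrite -surjective_pairing.
have GL x y u v : u <= v -> c * (v - u) <= G (x, y, v) - G (x, y, u).
  move=> uv; have := GS (x, y, u) (x, y, v).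
  by rewrite planar_gap0// mulr0 addr0 stretch_npos//= ?subr_le0//; lra.
split; first by move=> p; apply: (cvg_pair cvg_fst (Gc p)).
exists (fun q => (q.1, W q)); split.
- suff Wc : continuous W by move=> p; exact: (cvg_pair cvg_fst (Wc p)).
  apply: (@coordinatewise_lipschitz_continuous W (M / c) (1 / c)) => p q.
  have [pq|/ltW pq] := leP (W p) (W q).
    apply: (@le_trans _ _ 0); first by rewrite subr_le0.
    by rewrite addr_ge0// mulr_ge0 ?divr_ge0 ?addr_ge0// ltW.
  rewrite mulrAC div1r [c^-1 * _]mulrC -mulrDl ler_pdivlMr//.
  have := GL p.1.1 p.1.2 _ _ pq; rewrite -surjective_pairing WE.
  have := GS (q.1, W q) (p.1, W q); rewrite WE subrr/= /stretch !mulr0 maxxx add0r.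
  rewrite planar_gapC /planar_gap /=.
  by have := ler_norm (p.2 - q.2); lra.
- move=> -[[x y] z] /=; congr (_, _).
  have := WE (x, y, G (x, y, z)) => /= e.
  set w := W _ in e *; have [zw|/ltW zw] := leP z w; have := GL x y _ _ zw; rewrite e subrr.
    by rewrite pmulr_rle0//; lra.
  by rewrite pmulr_rle0//; lra.
- by move=> q /=; rewrite WE -surjective_pairing.
Qed.

(** The curves (x, y, h) and (x, y, h') have the same projection. The extension
    F of the new height from the first curve to space is the infimum of the
    upper bounds that the points of the curve impose; it takes the prescribed
    values because the hypothesis makes these bounds compatible. The condition
    on F is convex, so it holds along the straight path from the identity. *)
Lemma vertical_isotopy (I : Type) (x y h h' : I -> R) (i0 : I) (c C M : R) :
  0 < c -> c <= C -> 0 <= M ->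
  (forall i j, h' i - h' j <= stretch c C (h i - h j) +
     M * (`|x i - x j| + `|y i - y j|)) ->
  exists2 H, ambient_isotopy H & forall i, H 1 (x i, y i, h i) = (x i, y i, h' i).
Proof.
move=> c0 cC M0 hS; pose P i : R * R * R := (x i, y i, h i).
pose term p i := h' i + (stretch c C (p.2 - h i) + M * planar_gap p (P i)).
pose F p := inf [set term p i | i in setT].
have term_tri p q i : term p i <= term q i + (stretch c C (p.2 - q.2) + M * planar_gap p q).
  have := stretchD c C (p.2 - q.2) (q.2 - h i); rewrite addrA subrK => h1.
  have h2 : M * planar_gap p (P i) <= M * planar_gap p q + M * planar_gap q (P i).
    by rewrite -mulrDr ler_wpM2l// planar_gap_tri.
  by rewrite /term; lra.
have termP i : term (P i) i = h' i.
  by rewrite /term subrr /stretch !mulr0 maxxx planar_gap0// mulr0 !addr0.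
have term_lb i j : h' i <= term (P i) j.
  by have := hS i j; rewrite /term /planar_gap /=; lra.
have lbF p : has_lbound [set term p i | i in setT].
  exists (h' i0 - (stretch c C (h i0 - p.2) + M * planar_gap (P i0) p)) => _ [i _ <-].
  by have := term_lb i0 i; have := term_tri (P i0) p i; rewrite /=; lra.
have F_le p i : F p <= term p i by apply: ge_inf => //; exists i.
have F_ge p z : (forall i, z <= term p i) -> z <= F p.
  by move=> zt; apply: lb_le_inf; [exists (term p i0); exists i0|move=> _ [i _ <-]].
have FS : stretching c C M F.
  move=> p q; rewrite lerBlDr -lerBlDl; apply: F_ge => i.
  by have := F_le p i; have := term_tri p q i; lra.
have FP i : F (P i) = h' i.
  by apply/eqP; rewrite eq_le -{1}(termP i) F_le F_ge.
have Fc := stretching_continuous c0 cC FS.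
exists (fun l p => (p.1, (1 - l) * p.2 + l * F p)); last first.
  by move=> i; rewrite subrr mul0r add0r mul1r FP.
split.
- apply: continuous_subspaceT => -[l p].
  have p1 : lp.2.1 @[lp --> (l, p)] --> p.1 by apply: cvg_comp; [exact: cvg_snd|exact: cvg_fst].
  have p2 : (1 - lp.1) * lp.2.2 + lp.1 * F lp.2 @[lp --> (l, p)] --> (1 - l) * p.2 + l * F p.
    apply: cvgD; apply: cvgM.
    + by apply: cvgB; [exact: cvg_cst|exact: cvg_fst].
    + by apply: cvg_comp; [exact: cvg_snd|exact: cvg_snd].
    + exact: cvg_fst.
    + by apply: cvg_comp; [exact: cvg_snd|exact: Fc].
  exact: (cvg_pair p1 p2).
- by move=> p; rewrite subr0 mul1r mul0r addr0 -surjective_pairing.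
- move=> l; rewrite in_itv/= => l01; have [l0 l1] := andP l01.
  apply: (@stretching_homeo (1 - l + l * c) (1 - l + l * C) (l * M)).
  + have [->|ln0] := eqVneq l 0; first by rewrite subr0 mul0r addr0.
    by rewrite ltr_wpDl ?subr_ge0// mulr_gt0// lt_neqAle eq_sym ln0.
  + by rewrite lerD2l ler_wpM2l.
  + exact: mulr_ge0.
  + move=> p q; rewrite -stretch_mix//.
    by have := ler_wpM2l l0 (FS p q); rewrite !mulrDr; lra.
Qed.

End Isotopies.

(** * Isotopies that fix the azimuth or rotate space *)

Section Radial.
Variable R : realType.
Implicit Types (e w N l : R).

Definition acute e := 0 < e < pi / 2.

Lemma cos_acuteM e w : acute e -> -1 <= w <= 1 -> 0 < cos (e * w).
Proof.
move=> /andP[e0 e1] /andP[w0 w1]; apply: cos_gt0_pihalf; apply/andP; split; nra.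
Qed.

Lemma cos_acute e : acute e -> 0 < cos e.
Proof. by move=> /cos_acuteM/(_ (_ : -1 <= 1 <= 1)); rewrite mulr1; apply; lra. Qed.

Lemma tan_acute e : acute e -> 0 < tan e.
Proof.
move=> ae; rewrite /tan divr_gt0 ?cos_acute// sin_gt0_pi//.
by move: ae (pi_gt0 R) => /andP[? ?] ?; apply/andP; split; lra.
Qed.

(** A chord seen from the centre of the unit circle under the angle 2 e has at
    the angle e w from its middle the distance cos e / cos (e w) to the centre. *)
Definition edge_radius e w := cos e / cos (e * w).

(** The parameter w for which edge_radius e w has the square N. Outside the
    range of edge_radius e it is constant: below, because the square root of a
    negative number is 0, and above, because of the minimum. *)
Definition radial_level e N := Num.min 1 (atan (Num.sqrt (N / cos e ^+ 2 - 1)) / e).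

Lemma radial_level01 e N : acute e -> 0 <= radial_level e N <= 1.
Proof.
move=> ae; rewrite /radial_level ge_min lexx/= le_min ler01/= divr_ge0//.
  by rewrite -atan0 le_atan// sqrtr_ge0.
by have /andP[/ltW] := ae.
Qed.

Lemma edge_radius_gt0 e w : acute e -> -1 <= w <= 1 -> 0 < edge_radius e w.
Proof. by move=> ae w1; apply: divr_gt0; [exact: cos_acute|exact: cos_acuteM]. Qed.

Lemma radial_level_radius e w : acute e -> 0 <= w <= 1 ->
  radial_level e (edge_radius e w ^+ 2) = w.
Proof.
move=> ae /andP[w0 w1]; have /andP[e0 e1] := ae.
have c0 := cos_acute ae; have cw : 0 < cos (e * w) by apply: cos_acuteM => //; lra.
rewrite /radial_level; have -> : edge_radius e w ^+ 2 / cos e ^+ 2 - 1 = tan (e * w) ^+ 2.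
  rewrite /edge_radius -[RHS](addKr 1) -cos2_tan2 ?gt_eqF// addrC; congr (_ + _).
  by field; rewrite !gt_eqF.
have ew : 0 <= e * w < pi / 2 by apply/andP; split; nra.
have t0 : 0 <= tan (e * w).
  rewrite /tan divr_ge0 ?(ltW cw)// sin_ge0_pi//.
  by have := pi_gt0 R; move: ew => /andP[? ?] ?; apply/andP; split; lra.
rewrite sqrtr_sqr ger0_norm// tanK ?in_itv/=; last first.
  by have := pi_gt0 R; move: ew => /andP[? ?] ?; apply/andP; split; lra.
by rewrite mulrAC mulfV ?gt_eqF// mul1r; apply/min_idPr.
Qed.

Lemma edge_radius_level e N : acute e -> cos e ^+ 2 <= N <= 1 ->
  N = edge_radius e (radial_level e N) ^+ 2.
Proof.
move=> ae /andP[N0 N1]; have /andP[e0 e1] := ae; have c0 := cos_acute ae.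
have t0 := tan_acute ae; have c2 : 0 < cos e ^+ 2 by rewrite exprn_gt0.
have y0 : 0 <= N / cos e ^+ 2 - 1 by rewrite subr_ge0 ler_pdivlMr// mul1r.
rewrite /radial_level /edge_radius; set y := Num.sqrt _.
have : atan y <= e.
  rewrite -[leRHS](@tanK _ e) ?in_itv/=; last by apply/andP; split; lra.
  apply: le_atan; rewrite -[leRHS](ger0_norm (ltW t0)) -sqrtr_sqr ler_wsqrtr//.
  rewrite lerBlDl -cos2_tan2 ?gt_eqF// ler_pdivrMr// mulVf// gt_eqF//.
rewrite -[leRHS]mul1r -ler_pdivrMr// => /min_idPr ->.
rewrite mulrCA mulfV ?gt_eqF// mulr1 cos_atan sqr_sqrtr// invrK exprMn sqr_sqrtr; last lra.
by rewrite addrC subrK mulrC divfK// gt_eqF.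
Qed.

Lemma radial_level_inside e N : acute e -> N <= cos e ^+ 2 -> radial_level e N = 0.
Proof.
move=> ae Ne; have c0 := cos_acute ae.
rewrite /radial_level ler0_sqrtr ?atan0 ?mul0r; last first.
  by rewrite subr_le0 ler_pdivrMr ?mul1r// exprn_gt0.
by apply/min_idPr; exact: ler01.
Qed.

Lemma radial_level_outside e N : acute e -> 1 <= N -> radial_level e N = 1.
Proof.
move=> ae N1; have c0 := cos_acute ae; have t0 := tan_acute ae; have /andP[e0 e1] := ae.
have c2 : 0 < cos e ^+ 2 by rewrite exprn_gt0.
apply/min_idPl; rewrite ler_pdivlMr// mul1r.
rewrite -[leLHS](@tanK _ e) ?in_itv/=; last by apply/andP; split; lra.
apply: le_atan; rewrite -[leLHS](ger0_norm (ltW t0)) -sqrtr_sqr ler_wsqrtr//.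
by rewrite lerBrDl -cos2_tan2 ?gt_eqF// ler_pdivlMr// mulVf// gt_eqF.
Qed.

(** The factor by which the distance to the axis changes at points with squared
    distance N. It is constant near the axis and 1 outside the unit cylinder. *)
Definition radial_factor e e' N :=
  edge_radius e' (radial_level e N) / edge_radius e (radial_level e N).

Lemma edge_radius0 e : edge_radius e 0 = cos e.
Proof. by rewrite /edge_radius mulr0 cos0 divr1. Qed.

Lemma edge_radius1 e : acute e -> edge_radius e 1 = 1.
Proof. by move=> ae; rewrite /edge_radius mulr1 divff// gt_eqF// cos_acute. Qed.

(** This makes the radial map from e to e' invertible, with the radial map from
    e' to e as inverse. *)
Lemma radial_level_factor e e' N : acute e -> acute e' ->
  radial_level e' (N * radial_factor e e' N ^+ 2) = radial_level e N.
Proof.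
move=> ae ae'; have c0 := cos_acute ae; have c0' := cos_acute ae'.
rewrite /radial_factor.
have [Ne|/ltW Ne] := leP N (cos e ^+ 2).
  rewrite (radial_level_inside ae Ne) radial_level_inside// !edge_radius0//.
  by rewrite expr_div_n mulrA ler_pdivrMr ?exprn_gt0// mulrC ler_wpM2l// sqr_ge0.
have [N1|/ltW N1] := leP N 1; last first.
  rewrite (radial_level_outside ae N1) radial_level_outside// !edge_radius1//.
  by rewrite divr1 expr1n mulr1.
have k01 := radial_level01 N ae; have := @edge_radius_level e N ae.
rewrite Ne N1 => /(_ isT); set k := radial_level e N in k01 * => ->.
have r0 : edge_radius e k != 0 by rewrite gt_eqF// edge_radius_gt0//; lra.
by rewrite -exprMn mulrCA mulfV// mulr1 radial_level_radius.
Qed.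

Lemma radial_factorK e e' N : acute e -> acute e' ->
  radial_factor e e' N * radial_factor e' e (N * radial_factor e e' N ^+ 2) = 1.
Proof.
move=> ae ae'; rewrite {2}/radial_factor radial_level_factor// /radial_factor.
have k01 := radial_level01 N ae; set k := radial_level e N in k01 *.
have r0 : edge_radius e k != 0 by rewrite gt_eqF// edge_radius_gt0//; lra.
have r1 : edge_radius e' k != 0 by rewrite gt_eqF// edge_radius_gt0//; lra.
by rewrite mulrA divfK// mulfV.
Qed.

Lemma radial_factor_continuous e e' N : acute e -> acute e' ->
  {for (e', N), continuous (fun z : R * R => radial_factor e z.1 z.2)}.
Proof.
move=> ae ae'; have c0 := cos_acute ae; have /andP[e0 _] := ae.
have kc : {for N, continuous (radial_level e)}.
  apply: (@continuous_min _ _ (fun=> 1) _ N); first exact: cst_continuous.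
  apply: cvgMl; apply: continuous_comp; last exact: continuous_atan.
  apply: continuous_comp; last exact: sqrt_continuous.
  by apply: cvgB; [apply: cvgMl; exact: cvg_id|exact: cvg_cst].
have k1 : {for (e', N), continuous (fun z : R * R => radial_level e z.2)}.
  by apply: continuous_comp; [exact: cvg_snd|exact: kc].
have cosc (f : R * R -> R) x : f z @[z --> (e', N)] --> x ->
    cos (f z) @[z --> (e', N)] --> cos x.
  by move=> fx; apply: (cvg_comp _ _ fx); exact: continuous_cos.
have k01 := radial_level01 N ae; rewrite /radial_factor /edge_radius.
rewrite /prop_for /continuous_at /= in k1 *.
apply: cvgM; [apply: cvgM|apply: cvgV].
- by apply: cosc; exact: cvg_fst.
- apply: cvgV; first by rewrite gt_eqF// cos_acuteM//; lra.
  by apply: cosc; apply: cvgM; [exact: cvg_fst|exact: k1].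
- by rewrite gt_eqF// divr_gt0// cos_acuteM//; lra.
- apply: cvgM; first exact: cvg_cst.
  apply: cvgV; first by rewrite gt_eqF// cos_acuteM//; lra.
  by apply: cosc; apply: cvgM; [exact: cvg_cst|exact: k1].
Qed.


Lemma continuous_paired (T U V : topologicalType) (f : T -> U) (g : T -> V) x :
  {for x, continuous f} -> {for x, continuous g} -> {for x, continuous (fun t => (f t, g t))}.
Proof. by move=> fx gx; exact: (cvg_pair fx gx). Qed.

Lemma continuous_pairl (T U : topologicalType) (t : T) : continuous (pair t : U -> T * U).
Proof.
by move=> x; apply: continuous_paired; [exact: cst_continuous|exact: cvg_id].
Qed.

(** Providing the inverse homeomorphisms explicitly avoids any continuity
    argument for inverse functions. *)
Lemma ambient_isotopy_inverse (H G : R -> R * R * R -> R * R * R) :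
  (forall t p, t \in `[0, 1] -> {for (t, p), continuous (fun z => H z.1 z.2)}) ->
  (forall t, t \in `[0, 1] -> continuous (G t)) ->
  (forall p, H 0 p = p) ->
  (forall t, t \in `[0, 1] -> cancel (H t) (G t) /\ cancel (G t) (H t)) ->
  ambient_isotopy H.
Proof.
move=> Hc Gc H0 HG; split => //.
  by apply/subspace_continuousP => -[t p] tI; apply: cvg_within_filter; exact: Hc.
move=> t tI; have [HGt GHt] := HG t tI; split; last by exists (G t); split; [exact: Gc| |].
move=> p; apply: (@continuous_comp _ _ _ (pair t) (fun z => H z.1 z.2)); last exact: Hc.
exact: continuous_pairl.
Qed.

Definition radial_map e e' (p : R * R * R) : R * R * R :=
  let q := radial_factor e e' (p.1.1 ^+ 2 + p.1.2 ^+ 2) in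
  (p.1.1 * q, p.1.2 * q, p.2).

Lemma radial_mapK e e' : acute e -> acute e' -> cancel (radial_map e e') (radial_map e' e).
Proof.
move=> ae ae' [[x y] z]; rewrite /radial_map /=.
have := @radial_factorK e e' (x ^+ 2 + y ^+ 2) ae ae'.
move: (radial_factor e e' _) => q.
have -> : (x * q) ^+ 2 + (y * q) ^+ 2 = (x ^+ 2 + y ^+ 2) * q ^+ 2 by ring.
by move: (radial_factor e' e _) => q' qq; rewrite -!mulrA qq !mulr1.
Qed.

Lemma radial_factorxx e N : acute e -> radial_factor e e N = 1.
Proof.
move=> ae; rewrite /radial_factor divff// gt_eqF// edge_radius_gt0//.
by have := radial_level01 N ae; lra.
Qed.

Lemma continuous_coords (P : R * (R * R * R)) :
  [/\ {for P, continuous (fun u : R * (R * R * R) => u.2.1.1)},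
      {for P, continuous (fun u : R * (R * R * R) => u.2.1.2)} &
      {for P, continuous (fun u : R * (R * R * R) => u.2.2)}].
Proof.
have c2 : {for P, continuous (snd : R * (R * R * R) -> _)} by exact: cvg_snd.
have c21 : {for P, continuous (fun u : R * (R * R * R) => u.2.1)}.
  by apply: continuous_comp; [exact: c2|exact: cvg_fst].
split.
- by apply: (@continuous_comp _ _ _ (fun u : R * (R * R * R) => u.2.1) fst P c21); exact: cvg_fst.
- by apply: (@continuous_comp _ _ _ (fun u : R * (R * R * R) => u.2.1) snd P c21); exact: cvg_snd.
- by apply: continuous_comp; [exact: c2|exact: cvg_snd].
Qed.

Lemma radial_map_continuous e (f : R -> R) t (p : R * R * R) :
  acute e -> acute (f t) -> {for t, continuous f} ->
  {for (t, p), continuous (fun z => radial_map e (f z.1) z.2)}.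
Proof.
move=> ae aft ft; rewrite /radial_map; set P := (t, p).
have fc : {for P, continuous (fun u : R * (R * R * R) => f u.1)}.
  by apply: (@continuous_comp _ _ _ fst f); [exact: cvg_fst|exact: ft].
have [cx cy cz] := continuous_coords P.
have cn : {for P, continuous (fun u : R * (R * R * R) => u.2.1.1 ^+ 2 + u.2.1.2 ^+ 2)}.
  by apply: cvgD; [apply: (cvgM cx cx)|apply: (cvgM cy cy)].
have cp : {for P, continuous (fun u : R * (R * R * R) => (f u.1, u.2.1.1 ^+ 2 + u.2.1.2 ^+ 2))}.
  exact: (cvg_pair fc cn).
have cq : {for P, continuous (fun u : R * (R * R * R) => radial_factor e (f u.1) (u.2.1.1 ^+ 2 + u.2.1.2 ^+ 2))}.
  apply: (@continuous_comp _ _ _ _ (fun z : R * R => radial_factor e z.1 z.2) P cp).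
  exact: radial_factor_continuous.
exact: (cvg_pair (cvg_pair (cvgM cx cq) (cvgM cy cq)) cz).
Qed.

(** The isotopy runs through the half angles between e and e', so that each of
    its stages is a radial map and has a known inverse. *)
Lemma radial_isotopy e e' : acute e -> acute e' ->
  exists2 H, ambient_isotopy H & forall w u v z, 0 <= w <= 1 -> u ^+ 2 + v ^+ 2 = 1 ->
    H 1 (edge_radius e w * u, edge_radius e w * v, z) =
    (edge_radius e' w * u, edge_radius e' w * v, z).
Proof.
move=> ae ae'; pose f t := (1 - t) * e + t * e'.
have af t : t \in `[0, 1] -> acute (f t).
  move=> /itvP tI; have [/andP[e0 e1] /andP[e0' e1']] := (ae, ae').
  have [t0 t1] : 0 <= t /\ t <= 1 by rewrite !tI.
  have [->|tn0] := eqVneq t 0; first by rewrite /f subr0 mul1r mul0r addr0.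
  have {}t0 : 0 < t by rewrite lt_neqAle eq_sym tn0.
  by rewrite /acute /f; apply/andP; split; nra.
have fc : continuous f.
  move=> t; apply: cvgD; apply: cvgMl; last exact: cvg_id.
  by apply: cvgB; [exact: cvg_cst|exact: cvg_id].
exists (fun t => radial_map e (f t)).
- apply: (@ambient_isotopy_inverse _ (fun t => radial_map (f t) e)).
  + by move=> t p tI; apply: radial_map_continuous => //; [exact: af|exact: fc].
  + move=> t tI p.
    apply: (@continuous_comp _ _ _ (pair t) (fun z => radial_map (f t) e z.2)).
      exact: continuous_pairl.
    by apply: (@radial_map_continuous (f t) (fun=> e)) => //; [exact: af|exact: cst_continuous].
  + move=> [[x y] z]; rewrite /radial_map /f subr0 mul1r mul0r addr0.
    by rewrite radial_factorxx// !mulr1.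
  + by move=> t tI; split; apply: radial_mapK => //; exact: af.
- move=> w u v z w01 uv1; rewrite /radial_map /f subrr mul0r add0r mul1r /=.
  have := edge_radius_gt0 ae (_ : -1 <= w <= 1) => /(_ ltac:(lra)) r0.
  have -> : (edge_radius e w * u) ^+ 2 + (edge_radius e w * v) ^+ 2 = edge_radius e w ^+ 2.
    by rewrite !exprMn -mulrDr uv1 mulr1.
  rewrite /radial_factor radial_level_radius//.
  by congr (_, _, _); field; rewrite gt_eqF.
Qed.

Definition rotate_z w (p : R * R * R) : R * R * R :=
  (cos w * p.1.1 - sin w * p.1.2, sin w * p.1.1 + cos w * p.1.2, p.2).

Definition rotate_x w (p : R * R * R) : R * R * R :=
  (p.1.1, cos w * p.1.2 - sin w * p.2, sin w * p.1.2 + cos w * p.2).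

Lemma rotation_isotopy (rot : R -> R * R * R -> R * R * R) w :
  (forall v (p : R * R * R), {for (v, p), continuous (fun z => rot z.1 z.2)}) ->
  (forall p, rot 0 p = p) ->
  (forall v, cancel (rot v) (rot (- v))) ->
  ambient_isotopy (fun t => rot (t * w)).
Proof.
move=> rotc rot0 rotK.
have lin (p : R * (R * R * R)) :
    {for p, continuous (fun z : R * (R * R * R) => (z.1 * w, z.2))}.
  by apply: continuous_paired; [apply: cvgMl; exact: cvg_fst|exact: cvg_snd].
apply: (@ambient_isotopy_inverse _ (fun t => rot (- (t * w)))).
- move=> t p _.
  apply: (@continuous_comp _ _ _ (fun z : R * (R * R * R) => (z.1 * w, z.2)) (fun z => rot z.1 z.2)).
    exact: lin.
  exact: rotc.
- move=> t _ p.
  by apply: (@continuous_comp _ _ _ (pair (- (t * w))) (fun z => rot z.1 z.2)); [exact: continuous_pairl|exact: rotc].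
- by move=> p; rewrite mul0r.
- by move=> t _; split=> // p; rewrite -{1}[t * w]opprK rotK.
Qed.

Lemma rotate_z_isotopy w : ambient_isotopy (fun t => rotate_z (t * w)).
Proof.
apply: rotation_isotopy => [v p|[[x y] z]|v [[x y] z]]; last 2 first.
- by rewrite /rotate_z cos0 sin0 !mul1r !mul0r subr0 add0r.
- rewrite /rotate_z cosN sinN /=; have := cos2Dsin2 v.
  move: (cos v) (sin v) => c s cs; congr (_, _, _).
    by rewrite -[RHS]mul1r -cs; ring.
  by rewrite -[RHS]mul1r -cs; ring.
set P := (v, p); have [cx cy cz] := continuous_coords P.
have cc : {for P, continuous (fun z : R * (R * R * R) => cos z.1)}.
  by apply: continuous_comp; [exact: cvg_fst|exact: continuous_cos].
have cs : {for P, continuous (fun z : R * (R * R * R) => sin z.1)}.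
  by apply: continuous_comp; [exact: cvg_fst|exact: continuous_sin].
exact: (cvg_pair (cvg_pair (cvgB (cvgM cc cx) (cvgM cs cy)) (cvgD (cvgM cs cx) (cvgM cc cy))) cz).
Qed.

Lemma rotate_x_isotopy w : ambient_isotopy (fun t => rotate_x (t * w)).
Proof.
apply: rotation_isotopy => [v p|[[x y] z]|v [[x y] z]]; last 2 first.
- by rewrite /rotate_x cos0 sin0 !mul1r !mul0r subr0 add0r.
- rewrite /rotate_x cosN sinN /=; have := cos2Dsin2 v.
  move: (cos v) (sin v) => c s cs; congr (_, _, _).
    by rewrite -[RHS]mul1r -cs; ring.
  by rewrite -[RHS]mul1r -cs; ring.
set P := (v, p); have [cx cy cz] := continuous_coords P.
have cc : {for P, continuous (fun z : R * (R * R * R) => cos z.1)}.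
  by apply: continuous_comp; [exact: cvg_fst|exact: continuous_cos].
have cs : {for P, continuous (fun z : R * (R * R * R) => sin z.1)}.
  by apply: continuous_comp; [exact: cvg_fst|exact: continuous_sin].
exact: (cvg_pair (cvg_pair cx (cvgB (cvgM cc cy) (cvgM cs cz))) (cvgD (cvgM cs cy) (cvgM cc cz))).
Qed.

End Radial.

(** * The zigzag function and the coordinate along an edge *)

Section Zigzag.
Variable R : realType.
Implicit Types (s t x y : R) (k : int).

Lemma floor_bounds t : (Num.floor t)%:~R <= t < (Num.floor t)%:~R + 1.
Proof. by have := floor_itv t; rewrite intrD. Qed.

(** zigzag t is twice the distance of t to the nearest point of Z + 1/2. *)
Lemma zigzag_le t k : zigzag t <= 2 * `|t - k%:~R - 1 / 2|.
Proof.
rewrite /zigzag ler_pM2l//; have /andP[f0 f1] := floor_bounds t.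
have [kf|fk] := leP k (Num.floor t).
  have [->//|kf'] := eqVneq k (Num.floor t).
  have : (k + 1)%:~R <= (Num.floor t)%:~R :> R.
    by rewrite ler_int lezD1 lt_neqAle kf'.
  rewrite intrD => h; rewrite ler_norml; have := ler_norm (t - k%:~R - 1 / 2); lra.
have : (Num.floor t + 1)%:~R <= k%:~R :> R by rewrite ler_int lezD1.
rewrite intrD => h; rewrite ler_norml; have := ler_norm (- (t - k%:~R - 1 / 2)).
by rewrite normrN; lra.
Qed.

Lemma zigzag_ge0 t : 0 <= zigzag t. Proof. exact: mulr_ge0. Qed.

Lemma zigzag_le1 t : zigzag t <= 1.
Proof.
rewrite /zigzag; have := floor_bounds t; set f := (Num.floor t)%:~R => /andP[h0 h1].
suff : `|t - f - 1 / 2| <= 1 / 2 by lra.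
by rewrite ler_norml; lra.
Qed.

Lemma zigzagDz t k : zigzag (t + k%:~R) = zigzag t.
Proof. by rewrite /zigzag floorDrz ?intr_int// intrKfloor intrD; congr (_ * `|_|); ring. Qed.

Lemma zigzagN t : zigzag (- t) = zigzag t.
Proof.
have le s : zigzag (- s) <= zigzag s.
  have := zigzag_le (- s) (- Num.floor s - 1); rewrite /zigzag.
  suff -> : - s - (- Num.floor s - 1)%:~R - 1 / 2 = - (s - (Num.floor s)%:~R - 1 / 2) by rewrite normrN.
  by rewrite intrB intrN; field.
by apply/eqP; rewrite eq_le le/= -{1}[t]opprK le.
Qed.

Lemma zigzag_lipschitz s t : zigzag s - zigzag t <= 2 * `|s - t|.
Proof.
have := zigzag_le s (Num.floor t); rewrite {3}/zigzag.
have := ler_normD (s - t) (t - (Num.floor t)%:~R - 1 / 2).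
by have -> : s - t + (t - (Num.floor t)%:~R - 1 / 2) = s - (Num.floor t)%:~R - 1 / 2; [ring|lra].
Qed.

Lemma zigzag_lipschitz_norm s t : `|zigzag s - zigzag t| <= 2 * `|s - t|.
Proof.
rewrite ler_norml zigzag_lipschitz andbT lerNl opprB distrC; exact: zigzag_lipschitz.
Qed.

Lemma zigzag_continuous : continuous (@zigzag R).
Proof. exact: (lipschitz_real_continuous zigzag_lipschitz_norm). Qed.

Lemma zigzag_eq s t : zigzag s = zigzag t ->
  (exists k, s - t = k%:~R) \/ (exists k, s + t = k%:~R).
Proof.
rewrite /zigzag => /(mulfI (_ : (2 : R) != 0)) => /(_ ltac:(by rewrite pnatr_eq0)).
move=> /eqP; rewrite eqr_norm2 => /orP[] /eqP h; [left|right].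
  by exists (Num.floor s - Num.floor t); rewrite intrB; lra.
by exists (Num.floor s + Num.floor t + 1); rewrite !intrD; lra.
Qed.

Lemma zigzag_periodic s t k : s - t = k%:~R -> zigzag s = zigzag t.
Proof. by move=> h; rewrite -(subrK t s) h addrC zigzagDz. Qed.

Lemma zigzag_even s t k : s + t = k%:~R -> zigzag s = zigzag t.
Proof. by move=> h; rewrite -(zigzagN t) -(zigzagDz (- t) k) -h; congr zigzag; ring. Qed.

Lemma cosD2piz t k : cos (t + 2 * pi * k%:~R) = cos t.
Proof.
have nat u n : cos (u + 2 * pi * n%:R) = cos u :> R.
  by rewrite mulr_natr (mulr_natl pi 2) (periodicn (@cosD2pi R)).
case: (intP k) => [|n|n]; [by rewrite mulr0 addr0|exact: nat|].
by rewrite -(nat _ n.+1) mulrNz mulrN subrK.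
Qed.

Lemma sinD2piz t k : sin (t + 2 * pi * k%:~R) = sin t.
Proof.
have nat u n : sin (u + 2 * pi * n%:R) = sin u :> R.
  by rewrite mulr_natr (mulr_natl pi 2) (periodicn (@sinD2pi R)).
case: (intP k) => [|n|n]; [by rewrite mulr0 addr0|exact: nat|].
by rewrite -(nat _ n.+1) mulrNz mulrN subrK.
Qed.

(** With 2 pi v the remainder of s - t, cos (2 pi v) = 1 - 2 sin (pi v)^2 is
    less than 1 unless v = 0. *)
Lemma angle_mod_2pi s t : cos s = cos t -> sin s = sin t -> exists k, s - t = 2 * pi * k%:~R.
Proof.
move=> cE sE; have p0 := pi_gt0 R.
pose y := (s - t) / (2 * pi); exists (Num.floor y).
have /andP[f0 f1] := floor_bounds y.
set f := (Num.floor y)%:~R in f0 f1 *.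
have yE : s - t = 2 * pi * y by rewrite /y mulrC divfK// gt_eqF//; lra.
have c1 : cos (pi * (y - f) *+ 2) = 1.
  have -> : pi * (y - f) *+ 2 = s - t + 2 * pi * (- Num.floor y)%:~R.
    by rewrite yE intrN -/f mulr2n; ring.
  by rewrite cosD2piz cosB cE sE -!expr2 cos2Dsin2.
have [//|] := eqVneq y f; first by move=> <-.
move=> yf; have {}f0 : f < y by rewrite lt_neqAle eq_sym yf.
have : 0 < sin (pi * (y - f)) by apply: sin_gt0_pi; apply/andP; split; nra.
have := cos2Dsin2 (pi * (y - f)); move: c1; rewrite cos_mulr2n.
by move: (cos _) (sin _) => c S h1 h2 h3; nra.
Qed.

End Zigzag.

Section EdgeTime.
Variable R : realType.
Implicit Types (e w x y l L : R) (k : int).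

(** Between different cells the increment is a sum of increments over pieces of
    cells; the whole cells in between have slope 1, and l <= 1 <= L. *)
Lemma glue_slopes (f : R -> R) l L :
  (forall k, f k%:~R = k%:~R) ->
  (forall k x y, k%:~R <= x -> x <= y -> y <= k%:~R + 1 ->
     l * (y - x) <= f y - f x <= L * (y - x)) ->
  forall x y, x <= y -> l * (y - x) <= f y - f x <= L * (y - x).
Proof.
move=> fk fs x y xy; have fk1 k : f (k%:~R + 1) = k%:~R + 1.
  by have := fk (k + 1); rewrite intrD.
have := fs 0 0 1; rewrite (fk 0) -{1 3}[1]/(1%:~R) (fk 1) subr0 !mulr1 => /(_ ltac:(lra) ltac:(lra) ltac:(lra)) /andP[l1 L1].
have /andP[x0 x1] := floor_bounds x; have /andP[y0 y1] := floor_bounds y.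
have [yx|xy'] := leP (Num.floor y) (Num.floor x).
  have {}yx : (Num.floor y)%:~R <= (Num.floor x)%:~R :> R by rewrite ler_int.
  by apply: (fs (Num.floor x)); lra.
have {}xy' : (Num.floor x)%:~R + 1 <= (Num.floor y)%:~R :> R.
  by rewrite -[1]/(1%:~R) -intrD ler_int lezD1.
have /andP[h1 h2] := fs (Num.floor x) x ((Num.floor x)%:~R + 1) x0 (ltW x1) (lexx _).
have /andP[h3 h4] := fs (Num.floor y) (Num.floor y)%:~R y (lexx _) y0 (ltW y1).
move: h1 h2 h3 h4; rewrite fk fk1.
move: (Num.floor x)%:~R (Num.floor y)%:~R x0 x1 y0 y1 xy' => a b x0 x1 y0 y1 ab h1 h2 h3 h4.
have h5 : 0 <= (1 - l) * (b - (a + 1)) by apply: mulr_ge0; lra.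
have h6 : 0 <= (L - 1) * (b - (a + 1)) by apply: mulr_ge0; lra.
by apply/andP; split; lra.
Qed.

Lemma tan_slope e x y : acute e -> - e <= x -> x < y -> y <= e ->
  exists2 z, x < z < y & tan y - tan x = (cos z) ^- 2 * (y - x).
Proof.
move=> ae ex xy ye.
have c0 z : z \in `[x, y] -> 0 < cos z.
  by rewrite in_itv/= => /andP[? ?]; have /andP[? ?] := ae; apply: cos_gt0_pihalf; lra.
have dtan z : z \in `]x, y[ -> is_derive z 1 tan ((cos z) ^- 2).
  by move=> zI; apply: is_derive_tan; rewrite gt_eqF// c0// (subset_itv_oo_cc zI).
have [|z zI ->] := MVT xy dtan; last by exists z => //; rewrite in_itv in zI.
apply: continuous_in_subspaceT => z /set_mem zI.
by apply: continuous_tan; rewrite gt_eqF// c0.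
Qed.

(** Moving along a chord at constant speed, one reaches the angle e w from its
    middle after the fraction tan (e w) / tan e of half the chord. The shift is
    the delay against uniform turning, for one unit of time per chord. *)
Definition time_shift e w := (tan (e * w) / tan e - w) / 2.

(** The number of chords traversed when the edge coordinate is x. *)
Definition edge_time e x :=
  let k := (Num.floor x)%:~R in x + time_shift e (2 * (x - k) - 1).

Lemma time_shift1 e : acute e -> time_shift e 1 = 0.
Proof. by move=> /tan_acute t0; rewrite /time_shift mulr1 divff ?gt_eqF// subrr mul0r. Qed.

Lemma time_shiftN e w : time_shift e (- w) = - time_shift e w.
Proof. by rewrite /time_shift mulrN tanN; ring. Qed.

Lemma edge_timeE e k x : acute e -> k%:~R <= x <= k%:~R + 1 ->
  edge_time e x = x + time_shift e (2 * (x - k%:~R) - 1).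
Proof.
move=> ae /andP[kx xk]; rewrite /edge_time.
have [xk1|xk1] := ltP x (k%:~R + 1).
  by have -> : Num.floor x = k by apply: floor_def; rewrite intrD kx.
have -> : x = (k + 1)%:~R by rewrite intrD; apply/eqP; rewrite eq_le xk.
rewrite intrKfloor !intrD; congr (_ + _).
have -> : 2 * (k%:~R + 1 - k%:~R) - 1 = 1 :> R by ring.
by rewrite subrr mulr0 sub0r time_shiftN time_shift1// oppr0.
Qed.

Lemma edge_timeDz e x k : edge_time e (x + k%:~R) = edge_time e x + k%:~R.
Proof.
rewrite /edge_time floorDrz ?intr_int// intrKfloor intrD addrAC; congr (_ + _ + _).
by congr time_shift; ring.
Qed.

Lemma edge_timeN e x : acute e -> edge_time e (- x) = - edge_time e x.
Proof.
move=> ae; have /andP[f0 f1] := floor_bounds x.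
rewrite (@edge_timeE e (- Num.floor x - 1)) ?intrB ?intrN//; last by apply/andP; split; lra.
rewrite /edge_time [RHS]opprD -time_shiftN; congr (_ + time_shift _ _).
by ring.
Qed.

Lemma edge_time_int e k : acute e -> edge_time e k%:~R = k%:~R.
Proof.
move=> ae; rewrite (@edge_timeE _ k)//; last by lra.
by rewrite subrr mulr0 sub0r time_shiftN time_shift1// oppr0 addr0.
Qed.

Definition min_slope e := e / tan e.
Definition max_slope e := e / tan e * (cos e) ^- 2.

Lemma min_slope_gt0 e : acute e -> 0 < min_slope e.
Proof. by move=> ae; rewrite divr_gt0 ?tan_acute//; case/andP: ae. Qed.

Lemma edge_time_slope e x y : acute e -> x <= y ->
  min_slope e * (y - x) <= edge_time e y - edge_time e x <= max_slope e * (y - x).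
Proof.
move=> ae; apply: glue_slopes => {x y} [k|k x y kx xy yk]; first exact: edge_time_int.
have [e0 e1] := andP ae; have t0 := tan_acute ae; have c0 := cos_acute ae.
rewrite !(@edge_timeE _ k) ?kx ?yk ?(le_trans kx xy) ?(le_trans xy yk)//.
have [<-|xy'] := eqVneq x y; first by rewrite !subrr !mulr0 lexx.
have {}xy : x < y by rewrite lt_neqAle xy'.
set a := 2 * (x - _) - 1; set b := 2 * (y - _) - 1.
have ab : b - a = 2 * (y - x) by rewrite /a /b; ring.
have := @tan_slope e (e * a) (e * b) ae ltac:(rewrite /a; nra) ltac:(nra) ltac:(rewrite /b; nra).
move=> [z /andP[za zb] tanE].
have ze : `|z| < e.
  by rewrite ltr_norml; apply/andP; split; rewrite /a /b in za zb; nra.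
have z0 := normr_ge0 z; have p0 := pi_gt0 R.
have zc : cos e <= cos z <= 1.
  by rewrite cos_le1 andbT -(cos_norm z) ltW// ltr_cos// in_itv/=; lra.
have E : y + time_shift e b - (x + time_shift e a) = min_slope e * (cos z ^- 2) * (y - x).
  transitivity (y - x - (b - a) / 2 + (tan (e * b) - tan (e * a)) / (2 * tan e)).
    by rewrite /time_shift; field; rewrite gt_eqF.
  rewrite tanE -mulrBr ab /min_slope; field; rewrite !gt_eqF//; lra.
rewrite E; have m0 := min_slope_gt0 ae; have {}xy : 0 <= y - x by lra.
have cz : 0 < cos z by lra.
apply/andP; split; rewrite ler_wpM2r// /max_slope -/(min_slope e).
  rewrite ler_peMr ?(ltW m0)// invf_ge1 ?exprn_gt0//.
rewrite ler_wpM2l ?(ltW m0)// lef_pV2 ?posrE ?exprn_gt0//.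
by rewrite lerXn2r ?nnegrE ?(ltW cz) ?(ltW c0)//; lra.
Qed.

Lemma cos_slope e z : acute e -> `|z| < e -> 1 <= (cos z) ^- 2 <= (cos e) ^- 2.
Proof.
move=> ae ze; have c0 := cos_acute ae; have [e0 e1] := andP ae.
have z0 := normr_ge0 z; have p0 := pi_gt0 R.
have zc : cos e <= cos z by rewrite -(cos_norm z) ltW// ltr_cos// in_itv/=; lra.
have cz : 0 < cos z by lra.
rewrite invf_ge1 ?exprn_gt0// lef_pV2 ?posrE ?exprn_gt0//.
by rewrite expr_le1 ?(ltW cz)// cos_le1 lerXn2r ?nnegrE ?(ltW cz) ?(ltW c0).
Qed.

(** Strict convexity of the tangent on [0, e], in the form of two applications
    of the mean value theorem. *)
Lemma time_shift_lt0 e w : acute e -> 0 < w < 1 -> time_shift e w < 0.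
Proof.
move=> ae /andP[w0 w1]; have [e0 e1] := andP ae; have t0 := tan_acute ae.
have [z1 /andP[z10 z11]] := @tan_slope e 0 (e * w) ae ltac:(lra) ltac:(nra) ltac:(nra).
have [z2 /andP[z20 z21]] := @tan_slope e (e * w) e ae ltac:(nra) ltac:(nra) ltac:(lra).
have p0 := pi_gt0 R.
have cz2 : 0 < cos z2 by apply: cos_gt0_pihalf; lra.
have cz : cos z2 < cos z1 by rewrite ltr_cos ?in_itv//=; lra.
have : (cos z1) ^- 2 < (cos z2) ^- 2.
  rewrite ltf_pV2 ?posrE ?exprn_gt0//; last by lra.
  by rewrite ltrXn2r// ?nnegrE; lra.
move: (cos z1 ^- 2) (cos z2 ^- 2) => A B AB; rewrite tan0 !subr0 => tB tA.
have teE : tan e = A * (e * w) + B * (e - e * w) by rewrite -tA -tB; ring.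
rewrite /time_shift pmulr_llt0// subr_lt0 ltr_pdivrMr// tA teE.
have : 0 < (B - A) * (e * w * (1 - w)) by rewrite !mulr_gt0 ?subr_gt0.
lra.
Qed.

Lemma time_shift0 e : time_shift e 0 = 0.
Proof. by rewrite /time_shift mulr0 tan0; ring. Qed.

(** The slopes of the tangent on [0, e] lie between 1 and 1 / cos e ^+ 2. *)
Lemma time_shift_bound e w : acute e -> -1 <= w <= 1 ->
  `|time_shift e w| <= (1 - cos e ^+ 2) / 2.
Proof.
move=> ae; have [e0 e1] := andP ae; have t0 := tan_acute ae; have c0 := cos_acute ae.
wlog w0 : w / 0 <= w => [hw /andP[w0 w1]|/andP[_ w1]].
  have [|/ltW w0'] := leP 0 w; first by move/hw; apply; lra.
  by rewrite -normrN -time_shiftN hw//; lra.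
have cle : cos e ^+ 2 <= 1 by rewrite expr_le1 ?cos_le1// ltW.
have [->|wn0] := eqVneq w 0; first by rewrite time_shift0 normr0; lra.
have [->|wn1] := eqVneq w 1; first by rewrite time_shift1// normr0; lra.
have {}w0 : 0 < w by rewrite lt_neqAle eq_sym wn0.
have {}w1 : w < 1 by rewrite lt_neqAle wn1.
have := @time_shift_lt0 e w ae ltac:(lra) => s0.
rewrite ler0_norm ?(ltW s0)// /time_shift.
suff : w * cos e ^+ 2 <= tan (e * w) / tan e.
  by move: (tan _ / _) => q qw; nra.
have [z1 /andP[z10 z11]] := @tan_slope e 0 (e * w) ae ltac:(lra) ltac:(nra) ltac:(nra).
have [z2 /andP[z20 z21]] := @tan_slope e 0 e ae ltac:(lra) ltac:(lra) ltac:(lra).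
rewrite tan0 !subr0 => -> ->.
have /andP[a1 _] := @cos_slope e z1 ae ltac:(rewrite ger0_norm; nra).
have /andP[_ a2] := @cos_slope e z2 ae ltac:(rewrite ger0_norm; lra).
have /andP[a3 _] := @cos_slope e z2 ae ltac:(rewrite ger0_norm; lra).
move: (cos z1 ^- 2) (cos z2 ^- 2) a1 a2 a3 => A B a1 a2 a3.
have Bc : cos e ^+ 2 * B <= 1.
  by rewrite mulrC -ler_pdivlMr ?exprn_gt0// mul1r.
rewrite ler_pdivlMr ?mulr_gt0//; last lra.
have -> : w * cos e ^+ 2 * (B * e) = cos e ^+ 2 * B * (e * w) by ring.
by rewrite ler_pM2r ?mulr_gt0//; lra.
Qed.

Lemma edge_time_shift_bound e x : acute e -> `|edge_time e x - x| <= (1 - cos e ^+ 2) / 2.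
Proof.
move=> ae; rewrite /edge_time addrC addKr time_shift_bound//.
by have := floor_bounds x; lra.
Qed.

(** The sign is the one of 1/2 minus the fractional part of x, for every half
    angle. This is the reason why the limit of a to infinity exists even if
    the limit curve is not embedded. *)
Lemma edge_time_shift_sign e e' x : acute e -> acute e' ->
  (forall k, 2 * x != k%:~R) -> 0 < (edge_time e x - x) * (edge_time e' x - x).
Proof.
move=> ae ae' xk; rewrite /edge_time ![x + _]addrC !addrK.
have /andP[f0 f1] := floor_bounds x.
have f0' : (Num.floor x)%:~R != x.
  by apply: contra (xk (Num.floor x + Num.floor x)) => /eqP fx; rewrite intrD fx; apply/eqP; ring.
set w := 2 * _ - 1; have wn0 : w != 0.
  apply: contra (xk (Num.floor x + Num.floor x + 1)); rewrite /w => /eqP w0.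
  by rewrite !intrD; apply/eqP; lra.
have {}f0 : (Num.floor x)%:~R < x by rewrite lt_neqAle f0'.
have w1 : -1 < w < 1 by rewrite /w; lra.
clearbody w; have [w0|w0] := ltP 0 w.
  by rewrite nmulr_rgt0 time_shift_lt0//; lra.
have {}w0 : w < 0 by rewrite lt_neqAle wn0.
by rewrite -(opprK w) !(time_shiftN _ (- w)) mulrNN nmulr_rgt0 time_shift_lt0//; lra.
Qed.

(** The inverse of edge_time: the tangent replaced by the arctangent. *)
Definition edge_coord e y :=
  let k := (Num.floor y)%:~R in k + 1 / 2 + atan ((2 * (y - k) - 1) * tan e) / (2 * e).

Lemma edge_coordK e : acute e -> cancel (edge_coord e) (edge_time e).
Proof.
move=> ae y; have [e0 e1] := andP ae; have t0 := tan_acute ae.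
have /andP[f0 f1] := floor_bounds y; rewrite /edge_coord; set k := Num.floor y in f0 f1 *.
set u := _ * tan e; have atan_e : atan (tan e) = e.
  by rewrite tanK// in_itv/=; apply/andP; split; lra.
have ub : atan u < e by rewrite -[ltRHS]atan_e lt_atan// /u; nra.
have lb : - e <= atan u by rewrite -{1}atan_e -atanN le_atan// /u; nra.
have ue : -1 <= atan u / e < 1.
  by rewrite ler_pdivlMr// ltr_pdivrMr//; apply/andP; split; lra.
have E : atan u / (2 * e) = atan u / e / 2 by field; rewrite gt_eqF.
rewrite (@edge_timeE e k)//; last by rewrite E; lra.
set w := 2 * _ - 1; have -> : w = atan u / e by rewrite /w; field; rewrite gt_eqF.
rewrite /time_shift mulrCA mulfV ?gt_eqF// mulr1 atanK /u.
by field; rewrite !gt_eqF.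
Qed.

Lemma edge_time_inj e : acute e -> injective (edge_time e).
Proof.
move=> ae x y; wlog xy : x y / x <= y => [hw|]; first by case: (leP x y) => [|/ltW] /hw // h /esym/h.
have /andP[+ _] := edge_time_slope ae xy => h E.
move: h; rewrite E subrr pmulr_rle0 ?min_slope_gt0//; lra.
Qed.

Lemma edge_timeK e : acute e -> cancel (edge_time e) (edge_coord e).
Proof. by move=> ae x; apply: (edge_time_inj ae); rewrite edge_coordK. Qed.

Lemma edge_time_lt e x y : acute e -> x < y -> edge_time e x < edge_time e y.
Proof.
move=> ae xy; have /andP[+ _] := edge_time_slope ae (ltW xy).
have : 0 < min_slope e * (y - x) by rewrite mulr_gt0 ?min_slope_gt0// subr_gt0.
lra.
Qed.

Lemma edge_coordDz e y k : acute e -> edge_coord e (y + k%:~R) = edge_coord e y + k%:~R.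
Proof.
by move=> ae; apply: (edge_time_inj ae); rewrite edge_timeDz !edge_coordK.
Qed.

Lemma edge_coord_lt e x y : acute e -> x < y -> edge_coord e x < edge_coord e y.
Proof.
move=> ae xy; rewrite ltNge; apply/negP; rewrite le_eqVlt => /orP[/eqP E|].
  by move: xy; rewrite -(edge_coordK ae x) -E edge_coordK// ltxx.
by move=> /(edge_time_lt ae); rewrite !edge_coordK// ltNge (ltW xy).
Qed.

Lemma edge_time_lipschitz e x y : acute e ->
  `|edge_time e x - edge_time e y| <= max_slope e * `|x - y|.
Proof.
move=> ae; wlog xy : x y / y <= x => [hw|].
  by have [/hw//|/ltW/hw] := leP y x; rewrite distrC (distrC y).
have /andP[h1 h2] := edge_time_slope ae xy.
have h3 : 0 <= min_slope e * (x - y) by rewrite mulr_ge0 ?subr_ge0// ltW// min_slope_gt0.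
by rewrite !ger0_norm ?subr_ge0//; lra.
Qed.

Lemma edge_time_continuous e : acute e -> continuous (edge_time e).
Proof.
by move=> ae; apply: lipschitz_real_continuous => x y; exact: (edge_time_lipschitz x y ae).
Qed.

Lemma edge_coord_continuous e : acute e -> continuous (edge_coord e).
Proof.
move=> ae; apply: (@lipschitz_real_continuous _ _ (min_slope e)^-1) => z y.
wlog yz : y z / y <= z => [hw|].
  by have [/hw//|/ltW/hw] := leP y z; rewrite distrC (distrC y).
have cyz : edge_coord e y <= edge_coord e z.
  by move: yz; rewrite le_eqVlt => /orP[/eqP->//|/(edge_coord_lt ae)/ltW].
have /andP[h1 _] := edge_time_slope ae cyz; rewrite !edge_coordK// in h1.
by rewrite !ger0_norm ?subr_ge0// mulrC ler_pdivlMr ?min_slope_gt0// mulrC.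
Qed.

End EdgeTime.

(** * Order of the strands and the stretching estimate *)

Section Compactness.
Variable R : realType.

Lemma same_sign_path (f : R -> R) : continuous f ->
  (forall l, 0 <= l <= 1 -> f l != 0) -> 0 < f 0 * f 1.
Proof.
move=> fc fn0; rewrite ltNge; apply/negP => f01.
have [l] : exists2 l, l \in `[0, 1] & f l = 0.
  apply: IVT; [exact: ler01|exact: continuous_subspaceT|].
  rewrite ge_min le_max; have [f0|f0] := leP (f 0) 0; rewrite ?f0 ?orTb/=.
    have [//|f1] := leP 0 (f 1); first by rewrite orbT.
    have [//|f0'] := leP 0 (f 0).
    by move: f01; rewrite leNgt; rewrite nmulr_lgt0// f0'.
  by rewrite (ltW f0) andbT -(pmulr_rle0 _ f0).
by rewrite in_itv/= => /fn0/eqP.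
Qed.

Definition joint_gap (X Y : R -> R) x y := `|X x - X y| + `|Y x - Y y|.

(** Three kinds of pairs of points are to be compared. Close pairs satisfy the
    estimate because the heights are Lipschitz with respect to the projection.
    For the other pairs the distance of the projections or the product of the
    height differences is bounded below by compactness. If the projections are
    far apart, a large M suffices. Otherwise both height differences have the
    same sign and are bounded away from 0, so their quotient lies between two
    positive constants. *)
Lemma stretch_of_crossings (X Y h h' : R -> R) (p eta Lam : R) :
  0 < eta -> 2 * eta <= p -> 0 <= Lam ->
  [/\ continuous X, continuous Y, continuous h & continuous h'] ->
  (forall x (k : int), [/\ X (x + p * k%:~R) = X x, Y (x + p * k%:~R) = Y x,
    h (x + p * k%:~R) = h x & h' (x + p * k%:~R) = h' x]) ->
  (forall x, 0 <= h x <= 1) -> (forall x, 0 <= h' x <= 1) ->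
  (forall x y, `|x - y| <= eta -> `|h x - h y| + `|h' x - h' y| <= Lam * joint_gap X Y x y) ->
  (forall x y, eta <= `|x - y| <= p - eta -> X x = X y -> Y x = Y y ->
    0 < (h x - h y) * (h' x - h' y)) ->
  exists c C M, [/\ 0 < c, c <= C, 0 <= M & forall x y,
    h' x - h' y <= stretch c C (h x - h y) + M * joint_gap X Y x y].
Proof.
move=> eta0 etap Lam0 [Xc Yc hc hc'] per h01 h01' near cross.
pose E (z : R * R) := joint_gap X Y z.1 (z.1 + z.2) +
  Num.max 0 ((h z.1 - h (z.1 + z.2)) * (h' z.1 - h' (z.1 + z.2))).
have Ec : continuous E.
  have c2 (f : R -> R) : continuous f -> continuous (fun z : R * R => f z.1 - f (z.1 + z.2)).
    move=> fc z; apply: cvgB; apply: continuous_comp; try exact: fc; first exact: cvg_fst.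
    by apply: cvgD; [exact: cvg_fst|exact: cvg_snd].
  move=> z; apply: cvgD.
    by apply: cvgD; apply: cvg_norm; exact: c2.
  apply: (@continuous_max _ _ (fun=> 0) _ z); first exact: cst_continuous.
  by apply: cvgM; exact: c2.
pose Q : set (R * R) := `[0, p] `*` `[eta, p - eta].
have Qc : compact Q by apply: compact_setX; exact: segment_compact.
have Q0 : Q !=set0 by exists (0, eta); split; rewrite /= in_itv/=; lra.
have gap0 x y : 0 <= joint_gap X Y x y by rewrite addr_ge0.
have [[x0 w0] /set_mem[/= x0I w0I] Emin] := compact_EVT_min Q0 Qc (continuous_subspaceT Ec).
have Epos : 0 < E (x0, w0).
  rewrite /E /=; set D := (_ * _); have := gap0 x0 (x0 + w0).
  rewrite le_eqVlt => /orP[/eqP g0|g0]; last by rewrite ltr_pwDl// le_max lexx.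
  rewrite -g0 add0r lt_max ltxx/=; apply: cross.
  - rewrite opprD addNKr normrN; move: w0I; rewrite in_itv/= => w0I.
    by rewrite ger0_norm//; lra.
  - by move: g0; have := normr_ge0 (X x0 - X (x0 + w0));
      have := normr_ge0 (Y x0 - Y (x0 + w0)); rewrite /joint_gap => ? ? ?;
      apply/eqP; rewrite -subr_eq0 -normr_eq0; apply/eqP; lra.
  - by move: g0; have := normr_ge0 (X x0 - X (x0 + w0));
      have := normr_ge0 (Y x0 - Y (x0 + w0)); rewrite /joint_gap => ? ? ?;
      apply/eqP; rewrite -subr_eq0 -normr_eq0; apply/eqP; lra.
pose d := Num.min 1 (E (x0, w0)) / 2.
have d0 : 0 < d by rewrite divr_gt0// lt_min ltr01.
have d1 : d <= 1 / 2 by rewrite ler_pM2r// ge_min lexx.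
have dE : 2 * d <= E (x0, w0) by rewrite /d mulrC divfK// ge_min lexx orbT.
exists d, d^-1, (Num.max Lam (2 / d)).
have dV : 2 <= d^-1 by rewrite -[leLHS]invrK lef_pV2 ?posrE//; lra.
split => //; [lra|by rewrite le_max Lam0|].
(* x ranges over one period and w over the differences that are not close to a
   multiple of the period; E is at least 2 d there. *)
have far x w : 0 <= x <= p -> eta <= w <= p - eta ->
   h' x - h' (x + w) <= stretch d d^-1 (h x - h (x + w)) + (2 / d) * joint_gap X Y x (x + w).
  move=> xI wI; have : (x, w) \in Q by apply/mem_set; rewrite /Q /= !in_itv.
  move/Emin/(le_trans dE).
  rewrite /E /=; set D := h x - _; set D' := h' x - _; set g := joint_gap X Y x _ => Ege.
  have g0 : 0 <= g := gap0 _ _.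
  have [Dl Du] : -1 <= D /\ D <= 1.
    by have := h01 x; have := h01 (x + w); rewrite /D; lra.
  have [Dl' Du'] : -1 <= D' /\ D' <= 1.
    by have := h01' x; have := h01' (x + w); rewrite /D'; lra.
  have [s1 s2] : d * D <= stretch d d^-1 D /\ d^-1 * D <= stretch d d^-1 D.
    by split; rewrite stretch_ub.
  have [gd|gd] := leP d g.
    have : 2 <= 2 / d * g by rewrite mulrAC ler_pdivlMr// ler_pM2l.
    nra.
  have : d <= Num.max 0 (D * D') by lra.
  rewrite le_max leNgt d0/= => dDD.
  have g1 : 0 <= 2 / d * g by rewrite mulr_ge0// divr_ge0// ltW.
  have [D0|D0] := ltP 0 D.
    have D1 : d <= D by nra.
    have : 1 <= d^-1 * D by rewrite mulrC ler_pdivlMr// mul1r.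
    lra.
  have D'0 : D' <= 0.
    by rewrite leNgt; apply/negP => D'0; have := mulr_le0_ge0 D0 (ltW D'0); lra.
  have h1 : (D + 1) * D' <= 0 by apply: mulr_ge0_le0; lra.
  have h2 : - d <= d * D by rewrite -{1}(mulr1 d) -mulrN ler_pM2l.
  lra.
have close x y : `|x - y| <= eta ->
    h' x - h' y <= stretch d d^-1 (h x - h y) + Lam * joint_gap X Y x y.
  move=> /near xy; have [s1 _] := stretch_ub d d^-1 (h x - h y).
  have := ler_norm (h' x - h' y); have := ler_norm (- (h x - h y)); rewrite normrN => n1 n2.
  have n0 := normr_ge0 (h x - h y); nra.
have p0 : 0 < p by lra.
have red x : exists2 k : int, 0 <= x - p * k%:~R < p & True.
  exists (Num.floor (x / p)) => //; have := floor_bounds (x / p).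
  by rewrite ler_pdivlMr// ltr_pdivrMr// mulrDl mul1r (mulrC p); lra.
set M := Num.max _ _; have ML : Lam <= M /\ 2 / d <= M by rewrite !le_max !lexx orbT.
have weak x y K : K <= M ->
    h' x - h' y <= stretch d d^-1 (h x - h y) + K * joint_gap X Y x y ->
    h' x - h' y <= stretch d d^-1 (h x - h y) + M * joint_gap X Y x y.
  by move=> KM /le_trans; apply; rewrite lerD2l ler_wpM2r.
have base x w : 0 <= x < p -> 0 <= w < p ->
    h' x - h' (x + w) <= stretch d d^-1 (h x - h (x + w)) + M * joint_gap X Y x (x + w).
  move=> xI wI; have [we|ew] := leP w eta.
    by apply: (weak _ _ Lam ML.1); apply: close; rewrite opprD addNKr normrN ger0_norm//; lra.
  have [wp|pw] := leP w (p - eta).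
    by apply: (weak _ _ (2 / d) ML.2); apply: far; lra.
  have [eX eY eh eh'] := per x 1; rewrite /joint_gap -eX -eY -eh -eh'.
  apply: (weak _ _ Lam ML.1); apply: close; rewrite mulr1 ger0_norm; lra.
move=> x y; have [k kI _] := red x; have [l lI _] := red (y - x).
have := base _ _ kI lI; have -> : x - p * k%:~R + (y - x - p * l%:~R) = y + p * (- l - k)%:~R.
  by rewrite intrB intrN; ring.
have [eX eY eh eh'] := per y (- l - k); have [] := per x (- k).
rewrite intrN mulrN => eX1 eY1 eh1 eh1'.
by rewrite /joint_gap eX eY eh eh' eX1 eY1 eh1 eh1'.
Qed.

End Compactness.

(** * The strand in the edge coordinate and its crossings *)

Section Strand.
Variables (R : realType) (s n m : nat).
Hypotheses (s_gt0 : (0 < s)%N) (n_gt0 : (0 < n)%N) (m_gt0 : (0 < m)%N).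
Hypothesis coprime_sn : coprime s n.
Implicit Types (e x y l phi : R) (k j : int) (T : R -> R).

Let s0 : 0 < s%:R :> R. Proof. by rewrite ltr0n. Qed.
Let n0 : 0 < n%:R :> R. Proof. by rewrite ltr0n. Qed.
Let m0 : 0 < m%:R :> R. Proof. by rewrite ltr0n. Qed.

(** The azimuth in the identified slice, which goes s times around. *)
Definition turning x := 2 * pi * (s%:R * x / n%:R).

Definition planar_x e x := edge_radius e (zigzag x) * cos (turning x).
Definition planar_y e x := edge_radius e (zigzag x) * sin (turning x).
Definition height T phi x := zigzag (m%:R * T x / n%:R + phi).
Definition strand e T phi x : R * R * R := (planar_x e x, planar_y e x, height T phi x).

Lemma turningD x k : turning (x + n%:R * k%:~R) = turning x + 2 * pi * (s%:Z * k)%:~R.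
Proof. by rewrite /turning intrM; field; rewrite gt_eqF. Qed.

Lemma zigzagDnz x k : zigzag (x + n%:R * k%:~R) = zigzag x.
Proof. by rewrite -[n%:R]/(n%:Z%:~R) -intrM zigzagDz. Qed.

Lemma planar_periodic e x k :
  planar_x e (x + n%:R * k%:~R) = planar_x e x /\ planar_y e (x + n%:R * k%:~R) = planar_y e x.
Proof. by rewrite /planar_x /planar_y zigzagDnz turningD cosD2piz sinD2piz. Qed.

Lemma planar_eq e x y : acute e -> planar_x e x = planar_x e y -> planar_y e x = planar_y e y ->
  zigzag x = zigzag y /\ exists j, s%:R * (x - y) = n%:R * j%:~R.
Proof.
move=> ae eX eY; have z01 (u : R) : 0 <= zigzag u <= 1 by rewrite zigzag_ge0 zigzag_le1.
have r0 u : 0 < edge_radius e (zigzag u) by apply: edge_radius_gt0 => //; have := z01 u; lra.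
have sq u : planar_x e u ^+ 2 + planar_y e u ^+ 2 = edge_radius e (zigzag u) ^+ 2.
  by rewrite !exprMn -mulrDr cos2Dsin2 mulr1.
have zE : zigzag x = zigzag y.
  by rewrite -(radial_level_radius ae (z01 x)) -sq eX eY sq radial_level_radius.
split=> //; move: eX eY; rewrite /planar_x /planar_y zE.
move=> /mulfI-/(_ (lt0r_neq0 (r0 y))) cE /mulfI-/(_ (lt0r_neq0 (r0 y))) sE.
have [j jE] := angle_mod_2pi cE sE; exists j.
have p0 := pi_gt0 R; apply: (@mulfI _ (2 * pi)); first by rewrite gt_eqF//; lra.
transitivity (n%:R * (turning x - turning y)); last by rewrite jE; ring.
by rewrite /turning; field; rewrite gt_eqF.
Qed.

Lemma coprime_cancel (i j : int) : s%:R * i%:~R = n%:R * j%:~R :> R ->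
  exists k : int, i%:~R = n%:R * k%:~R :> R.
Proof.
rewrite -[s%:R]/(s%:Z%:~R) -[n%:R]/(n%:Z%:~R) -!intrM => /eqP; rewrite eqr_int => /eqP E.
have : (n %| s%:Z * i)%Z by rewrite E dvdz_mulr.
rewrite Gauss_dvdzr; last by rewrite coprimezE /= coprime_sym.
by move=> /dvdzP[k ->]; exists k; rewrite mulrC intrM.
Qed.

(** Each value of zigzag is attained at the points x + k and - x + k only. A
    difference x - y that is an integer must be a multiple of n, because s is
    invertible modulo n. *)
Lemma planar_crossing e x y : acute e -> planar_x e x = planar_x e y -> planar_y e x = planar_y e y ->
  (exists k, x - y = n%:R * k%:~R) \/
  exists k j, [/\ x + y = k%:~R, s%:R * (x - y) = n%:R * j%:~R & (1 < s)%N].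
Proof.
move=> ae eX eY; have [zE [j jE]] := planar_eq ae eX eY.
have int_case i : x - y = i%:~R -> exists k, x - y = n%:R * k%:~R.
  by move=> iE; rewrite iE; apply: (@coprime_cancel i j); rewrite -iE.
have [s1|s1] := leqP s 1.
  left; have s1' : s = 1%N by apply/eqP; rewrite eqn_leq s1.
  by exists j; rewrite -jE s1' mul1r.
by have [[i /int_case]|[k kE]] := zigzag_eq zE; [left|right; exists k, j].
Qed.

(** The properties of the edge times that exclude self-intersections: symmetry,
    and a shift that is small but vanishes only at vertices and midpoints of
    edges. The bound is the largest for which 2 m (T x - x) / n, the deviation
    from the limit in strand_inj, cannot reach the next multiple of 1/s. *)
Definition admissible T := [/\ (forall x k, T (x + k%:~R) = T x + k%:~R),
  (forall x, T (- x) = - T x),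
  (forall x, 2 * m%:R * s%:R * `|T x - x| < n%:R) &
  (forall x, T x = x -> exists k, 2 * x = k%:~R)].

(** If s = 1 then the projection has no crossings and all phases are allowed. *)
Definition generic phi := (1 < s)%N -> forall k j, m%:R * k%:~R / n%:R + 2 * phi != j%:~R.

(** At a crossing T x + T y is the integer k = x + y. If the heights agree then
    either m k / n + 2 phi is an integer, or 2 m s (T x - x) / n is an integer,
    hence 0 by the bound on the shift, so that x and y are vertices or midpoints
    of edges and x - y is an integer. *)
Lemma strand_inj e T phi x y : acute e -> admissible T -> generic phi ->
  strand e T phi x = strand e T phi y -> exists k, x - y = n%:R * k%:~R.
Proof.
move=> ae [TD TN Ts T0] gphi [eX eY] eh.
have [//|[k [j [kE jE s1]]]] := planar_crossing ae eX eY.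
have yE : y = - x + k%:~R by rewrite -kE; ring.
have TyE : T y = - T x + k%:~R by rewrite yE TD TN.
have [[l lE]|[l lE]] := zigzag_eq eh; last first.
  have /eqP[] := gphi s1 k l; rewrite -lE TyE; field; rewrite gt_eqF//.
have d0 : T x = x.
  have E : 2 * m%:R * s%:R * (T x - x) = n%:R * (s%:Z * l - m%:Z * j)%:~R.
    rewrite intrB !intrM.
    have -> : n%:R * (s%:Z%:~R * l%:~R - m%:Z%:~R * j%:~R) =
      s%:R * (n%:R * l%:~R) - m%:R * (n%:R * j%:~R) :> R by ring.
    rewrite -lE -jE TyE yE; field; rewrite gt_eqF//.
  have := Ts x; rewrite -(ger0_norm (_ : 0 <= 2 * m%:R * s%:R)); last by rewrite !mulr_ge0// ltW.
  rewrite -normrM E normrM (ger0_norm (ltW n0)) gtr_pMr// -intr_norm ltrz1.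
  move: E; set i := s%:Z * l - m%:Z * j; case: (eqVneq i 0) => [->|i0].
    rewrite mulr0 => /eqP; rewrite mulf_eq0 gt_eqF ?mulr_gt0//= subr_eq0 => /eqP.
    by [].
  by move=> _; rewrite ltNge -gtz0_ge1 normr_gt0 i0.
have [i iE] := T0 x d0.
have xyi : x - y = (i - k)%:~R by rewrite intrB -iE -kE; ring.
by rewrite xyi; apply: (@coprime_cancel _ j); rewrite -xyi.
Qed.

Lemma edge_time_admissible e : acute e -> m%:R * s%:R * (1 - cos e ^+ 2) < n%:R ->
  admissible (edge_time e).
Proof.
move=> ae small; split; [exact: edge_timeDz|by move=> x; exact: edge_timeN| |].
- move=> x; apply: le_lt_trans small.
  have -> : 2 * m%:R * s%:R * `|edge_time e x - x| = m%:R * s%:R * (2 * `|edge_time e x - x|) by ring.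
  by rewrite ler_wpM2l ?mulr_ge0//; have := edge_time_shift_bound x ae; lra.
- move=> x xE; apply: contrapT => /forallNP xk.
  have := @edge_time_shift_sign _ e e x ae ae (fun k => introN eqP (xk k)).
  by rewrite xE subrr mul0r ltxx.
Qed.

Definition mix (T T' : R -> R) l x := (1 - l) * T x + l * T' x.

(** A convex combination of two shifts of the same sign cannot vanish. *)
Lemma mix_admissible T T' l : 0 <= l <= 1 -> admissible T -> admissible T' ->
  (forall x, (forall k, 2 * x != k%:~R) -> 0 < (T x - x) * (T' x - x)) ->
  admissible (mix T T' l).
Proof.
move=> /andP[l0 l1] [TD TN Ts T0] [TD' TN' Ts' T0'] sgn; rewrite /mix; split.
- by move=> x k; rewrite TD TD'; ring.
- by move=> x; rewrite TN TN'; ring.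
- move=> x; have -> : (1 - l) * T x + l * T' x - x = (1 - l) * (T x - x) + l * (T' x - x) by ring.
  have := Ts x; have := Ts' x; set c := 2 * _ * _ => h' h.
  have c0 : 0 < c by rewrite !mulr_gt0.
  have := ler_normD ((1 - l) * (T x - x)) (l * (T' x - x)).
  rewrite !normrM (ger0_norm l0) (@ger0_norm _ (1 - l)) ?subr_ge0// => hn.
  apply: (@le_lt_trans _ _ (c * ((1 - l) * `|T x - x| + l * `|T' x - x|))).
    by rewrite ler_pM2l.
  have [->|ln0] := eqVneq l 0; first by rewrite subr0 mul1r mul0r addr0.
  have {}l0 : 0 < l by rewrite lt_neqAle eq_sym ln0.
  have h1 : (1 - l) * (c * `|T x - x|) <= (1 - l) * n%:R by rewrite ler_wpM2l ?subr_ge0// ltW.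
  have h2 : l * (c * `|T' x - x|) < l * n%:R by rewrite ltr_pM2l.
  have -> : c * ((1 - l) * `|T x - x| + l * `|T' x - x|) =
    (1 - l) * (c * `|T x - x|) + l * (c * `|T' x - x|) by ring.
  lra.
- move=> x E; apply: contrapT => /forallNP xk.
  have := sgn x (fun k => introN eqP (xk k)).
  have {E} : (1 - l) * (T x - x) + l * (T' x - x) = 0.
    by move: E => /eqP; rewrite -subr_eq0 => /eqP <-; ring.
  move: (T x - x) (T' x - x) => a b E ab.
  have [a0|a0|a0] := ltgtP a 0; last by rewrite a0 mul0r ltxx in ab.
    have b0 : b < 0 by rewrite nmulr_rgt0 in ab.
    have [l0'|l0'] := eqVneq l 0; first by rewrite l0' in E; lra.
    have : l * b < 0 by rewrite pmulr_rlt0// lt_neqAle eq_sym l0'.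
    have : (1 - l) * a <= 0 by rewrite mulr_ge0_le0 ?subr_ge0// ltW.
    lra.
  have b0 : 0 < b by rewrite pmulr_rgt0 in ab.
  have [l0'|l0'] := eqVneq l 0; first by rewrite l0' in E; lra.
  have : 0 < l * b by rewrite mulr_gt0// lt_neqAle eq_sym l0'.
  have : 0 <= (1 - l) * a by rewrite mulr_ge0 ?subr_ge0// ltW.
  lra.
Qed.

Lemma sin_lower (a : R) : `|a| <= 1 / 2 -> cos (1 / 2) * `|a| <= `|sin a|.
Proof.
wlog a0 : a / 0 <= a => [hw|].
  have [|/ltW a0] := leP 0 a; first exact: hw.
  by have := hw (- a); rewrite sinN !normrN; apply; rewrite oppr_ge0.
rewrite (ger0_norm a0) => a1; have := pi_ge2 R => p2.
have [->|an0] := eqVneq a 0; first by rewrite mulr0.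
have {}a0 : 0 < a by rewrite lt_neqAle eq_sym an0.
have [|c] := MVT a0 (fun z _ => is_derive_sin z).
  by apply: continuous_subspaceT => ?; exact: continuous_sin.
rewrite in_itv/= sin0 !subr0 => cI ->.
apply: le_trans (ler_norm _); rewrite ler_pM2r// ltW// ltr_cos ?in_itv//=; lra.
Qed.

Lemma edge_radius_bounds e w : acute e -> 0 <= w <= 1 -> cos e <= edge_radius e w <= 1.
Proof.
move=> ae w01; have c0 := cos_acute ae; have [e0 e1] := andP ae.
have cw : 0 < cos (e * w) by apply: cos_acuteM => //; lra.
rewrite /edge_radius ler_pdivlMr// ler_pdivrMr// mul1r.
rewrite ler_piMr ?cos_le1 ?(ltW c0)//=.
have [->|w1] := eqVneq w 1; first by rewrite mulr1.
have {}w1 : w < 1 by rewrite lt_neqAle w1; lra.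
have p0 := pi_gt0 R; rewrite ltW// ltr_cos ?in_itv/=; [|apply/andP; split|apply/andP; split]; nra.
Qed.

(** The projection is locally bilipschitz because the azimuth is: the cross
    product of two points of the unit disc is bounded by their distance, and it
    equals the product of the radii and the sine of the angle between them. *)
Lemma planar_gap_lower e x y : acute e -> `|x - y| <= n%:R / (4 * pi * s%:R) ->
  cos e ^+ 2 * cos (1 / 2) * (2 * pi * s%:R / n%:R) * `|x - y| <=
  joint_gap (planar_x e) (planar_y e) x y.
Proof.
move=> ae xy; have c0 := cos_acute ae; have p0 := pi_gt0 R.
have z01 (u : R) : 0 <= zigzag u <= 1 by rewrite zigzag_ge0 zigzag_le1.
have r0 u := edge_radius_bounds ae (z01 u).
have tE : turning x - turning y = 2 * pi * s%:R / n%:R * (x - y).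
  by rewrite /turning; field; rewrite gt_eqF.
have f0 : 0 < 2 * (pi : R) * s%:R / n%:R by rewrite divr_gt0// !mulr_gt0.
have tN : `|turning x - turning y| = 2 * pi * s%:R / n%:R * `|x - y|.
  by rewrite tE normrM (gtr0_norm f0).
have /sin_lower : `|turning x - turning y| <= 1 / 2.
  rewrite tN; apply: le_trans (ler_wpM2l (ltW f0) xy) _.
  by rewrite le_eqVlt; apply/orP; left; apply/eqP; move: (pi : R) p0 => q q0; field; rewrite !gt_eqF.
rewrite tN => sinl.
have cr : planar_y e x * planar_x e y - planar_x e x * planar_y e y =
    edge_radius e (zigzag x) * edge_radius e (zigzag y) * sin (turning x - turning y).
  by rewrite sinB /planar_x /planar_y; ring.
have cr2 : planar_y e x * planar_x e y - planar_x e x * planar_y e y =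
   planar_y e y * - (planar_x e x - planar_x e y) + planar_x e y * (planar_y e x - planar_y e y).
  ring.
have le1 u : `|planar_x e u| <= 1 /\ `|planar_y e u| <= 1.
  have /andP[r1 r2] := r0 u; have r3 : 0 <= edge_radius e (zigzag u) by lra.
  by split; rewrite normrM (ger0_norm r3) mulr_ile1// ?cos_max ?sin_max.
have up : `|planar_y e x * planar_x e y - planar_x e x * planar_y e y| <=
    joint_gap (planar_x e) (planar_y e) x y.
  have [yx1 yy1] := le1 y; rewrite cr2 /joint_gap.
  move: yx1 yy1 (planar_x e x - _) (planar_y e x - _).
  move: (planar_x e y) (planar_y e y) => a b a1 b1 u v.
  apply: le_trans (ler_normD _ _) _; rewrite !normrM normrN.
  by apply: lerD; rewrite ler_piMl.
apply: le_trans up; rewrite cr; have /andP[rx _] := r0 x; have /andP[ry _] := r0 y.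
move: (edge_radius e (zigzag x)) (edge_radius e (zigzag y)) rx ry => r r' rx ry.
have rr : cos e ^+ 2 <= r * r' by rewrite expr2 ler_pM// ltW.
have c2 : 0 <= cos e ^+ 2 := sqr_ge0 _.
rewrite normrM (ger0_norm (le_trans c2 rr)).
apply: le_trans (ler_wpM2r _ rr) => //; rewrite -(mulrA (_ ^+ 2)) -(mulrA (_ ^+ 2)).
by apply: ler_wpM2l => //; rewrite -mulrA.
Qed.

Lemma height_lipschitz T L phi x y : (forall x y, `|T x - T y| <= L * `|x - y|) ->
  `|height T phi x - height T phi y| <= 2 * (m%:R / n%:R) * L * `|x - y|.
Proof.
move=> TL; apply: le_trans (zigzag_lipschitz_norm _ _) _.
have -> : m%:R * T x / n%:R + phi - (m%:R * T y / n%:R + phi) = m%:R / n%:R * (T x - T y) by ring.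
have mn : 0 <= m%:R / n%:R :> R by rewrite divr_ge0.
by rewrite normrM (ger0_norm mn); have := ler_wpM2l mn (TL x y); lra.
Qed.

Lemma height_continuous T phi : continuous T -> continuous (height T phi).
Proof.
move=> Tc x; apply: (@continuous_comp _ _ _ (fun x => m%:R * T x / n%:R + phi)); last exact: zigzag_continuous.
by apply: cvgD; [apply: cvgMl; apply: cvgMr; exact: Tc|exact: cvg_cst].
Qed.

Lemma planar_continuous e : acute e -> continuous (planar_x e) /\ continuous (planar_y e).
Proof.
move=> ae; have tc : continuous turning.
  by move=> x; apply: cvgMr; apply: cvgMl; apply: cvgMr; exact: cvg_id.
have rc : continuous (fun x => edge_radius e (zigzag x)).
  move=> x; apply: cvgMr; apply: cvgV.
    by rewrite gt_eqF// cos_acuteM//; have := zigzag_ge0 x; have := zigzag_le1 x; lra.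
  apply: continuous_comp; last exact: continuous_cos.
  by apply: cvgMr; exact: zigzag_continuous.
split=> x; apply: cvgM; try exact: rc.
  by apply: continuous_comp; [exact: tc|exact: continuous_cos].
by apply: continuous_comp; [exact: tc|exact: continuous_sin].
Qed.

Lemma height_periodic T phi x k : (forall x k, T (x + k%:~R) = T x + k%:~R) ->
  height T phi (x + n%:R * k%:~R) = height T phi x.
Proof.
move=> TD; rewrite /height -[n%:R * _]/(n%:Z%:~R * _) -intrM TD.
apply: (@zigzag_periodic _ _ _ (m%:Z * k)); rewrite !intrM; field; rewrite gt_eqF//.
Qed.

(** Along the straight path from (T, phi) to (T', phi') the curve stays
    embedded, so at a crossing the difference of the heights does not change its
    sign; this is the crossing condition of stretch_of_crossings. *)
Lemma height_isotopy e T T' L phi phi' : acute e -> admissible T -> admissible T' ->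
  continuous T -> continuous T' -> 0 <= L ->
  (forall x y, `|T x - T y| <= L * `|x - y|) -> (forall x y, `|T' x - T' y| <= L * `|x - y|) ->
  (forall x, (forall k, 2 * x != k%:~R) -> 0 < (T x - x) * (T' x - x)) ->
  (forall l, 0 <= l <= 1 -> generic ((1 - l) * phi + l * phi')) ->
  exists2 H, ambient_isotopy H & forall x, H 1 (strand e T phi x) = strand e T' phi' x.
Proof.
move=> ae aT aT' Tc Tc' L0 TL TL' sgn gen.
have [Xc Yc] := planar_continuous ae; have c0 := cos_acute ae.
(* The azimuth changes by at most 1/2 over the length eta. *)
pose eta : R := n%:R / (4 * pi * s%:R).
have eta0 : 0 < eta by rewrite divr_gt0// !mulr_gt0// pi_gt0.
have etan : 2 * eta <= n%:R.
  have p2 := pi_ge2 R; have s1 : 1 <= s%:R :> R by rewrite ler1n.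
  rewrite /eta mulrA ler_pdivrMr; last by rewrite !mulr_gt0//; lra.
  by rewrite mulrC ler_pM2l//; nra.
pose kap : R := cos e ^+ 2 * cos (1 / 2) * (2 * pi * s%:R / n%:R).
have kap0 : 0 < kap.
  have p2 := pi_ge2 R; rewrite /kap !mulr_gt0// ?invr_gt0//; last lra.
  by apply: cos_gt0_pihalf; lra.
pose c : R := 2 * (m%:R / n%:R) * L.
have cc0 : 0 <= c by rewrite !mulr_ge0.
have Lam0 : 0 <= 2 * c / kap by apply: divr_ge0; [exact: mulr_ge0|exact: ltW].
have near x y : `|x - y| <= eta ->
    `|height T phi x - height T phi y| + `|height T' phi' x - height T' phi' y| <=
    (2 * c / kap) * joint_gap (planar_x e) (planar_y e) x y.
  move=> xy; have := planar_gap_lower ae xy; rewrite -/kap => g.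
  apply: (@le_trans _ _ (2 * c / kap * (kap * `|x - y|))); last first.
    exact: ler_wpM2l.
  rewrite mulrA divfK ?gt_eqF//.
  by have := height_lipschitz phi x y TL; have := height_lipschitz phi' x y TL'; rewrite -/c; lra.
have z01 S u v : 0 <= height S u v <= 1 by rewrite zigzag_ge0 zigzag_le1.
have per x k : [/\ planar_x e (x + n%:R * k%:~R) = planar_x e x,
    planar_y e (x + n%:R * k%:~R) = planar_y e x,
    height T phi (x + n%:R * k%:~R) = height T phi x &
    height T' phi' (x + n%:R * k%:~R) = height T' phi' x].
  have [-> ->] := planar_periodic e x k; have [TD _ _ _] := aT; have [TD' _ _ _] := aT'.
  by rewrite !height_periodic.
have cross x y : eta <= `|x - y| <= n%:R - eta -> planar_x e x = planar_x e y ->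
    planar_y e x = planar_y e y ->
    0 < (height T phi x - height T phi y) * (height T' phi' x - height T' phi' y).
  move=> xy eX eY; pose f l := height (mix T T' l) ((1 - l) * phi + l * phi') x -
     height (mix T T' l) ((1 - l) * phi + l * phi') y.
  have hc z : continuous (fun l => height (mix T T' l) ((1 - l) * phi + l * phi') z).
    move=> l; apply: (@continuous_comp _ _ _ (fun l => m%:R * mix T T' l z / n%:R + ((1 - l) * phi + l * phi'))); last exact: zigzag_continuous.
    have lin a b : (1 - l') * a + l' * b @[l' --> l] --> (1 - l) * a + l * b.
      apply: cvgD; apply: cvgMl; last exact: cvg_id.
      by apply: cvgB; [exact: cvg_cst|exact: cvg_id].
    by apply: cvgD; [apply: cvgMl; apply: cvgMr; exact: lin|exact: lin].
  have := @same_sign_path _ f.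
  rewrite /f /mix /height !subr0 !subrr !mul0r !mul1r !addr0 !add0r; apply.
    by move=> l; apply: cvgB; exact: hc.
  move=> l l01; rewrite subr_eq0; apply/eqP => eh.
  have [|k kE] := strand_inj ae (mix_admissible l01 aT aT' sgn) (gen l l01) (x := x) (y := y).
    by rewrite /strand eX eY; congr (_, _, _).
  move: xy; rewrite kE normrM (ger0_norm (ltW n0)) -intr_norm.
  case: (eqVneq k 0) => [->|k0]; first by rewrite normr0 mulr0; lra.
  have : 1 <= `|k|%:~R :> R by rewrite ler1z -gtz0_ge1 normr_gt0.
  by move=> k1 /andP[_]; have := ler_wpM2l (ltW n0) k1; lra.
have cont : [/\ continuous (planar_x e), continuous (planar_y e),
    continuous (height T phi) & continuous (height T' phi')].
  by split=> //; exact: height_continuous.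
have [c1 [C [M [c10 cC M0 hS]]]] := stretch_of_crossings eta0 etan Lam0 cont per
  (z01 T phi) (z01 T' phi') near cross.
exact: (vertical_isotopy (0 : R) c10 cC M0 hS).
Qed.

End Strand.

(** * The billiard curve of a slice *)

Section Polar.
Variable R : realType.
Implicit Types (e x y t phi : R) (k : int).

(** Otherwise the value 1/2 or - 1/2 is attained. *)
Lemma continuous_int_valued (f : R -> R) : {within `[0, 1], continuous f} -> f 0 = 0 ->
  (forall t, t \in `[0, 1] -> exists k, f t = k%:~R) -> forall t, t \in `[0, 1] -> f t = 0.
Proof.
move=> fc f0 fk t tI; have [k kE] := fk t tI; move: (tI); rewrite in_itv/= => /andP[t0 t1].
have fct : {within `[0, t], continuous f}.
  apply: continuous_subspaceW fc => x /=; rewrite !in_itv/= => /andP[-> xt].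
  exact: le_trans xt t1.
have half (v : R) : v = 1 / 2 \/ v = - (1 / 2) -> ~ exists j : int, v = j%:~R.
  move=> vE [j jE]; have : (2 * j)%:~R = 1%:~R :> R \/ (2 * j)%:~R = (- 1)%:~R :> R.
    by rewrite intrM intrN -jE; case: vE => ->; [left|right]; lra.
  by case=> /eqP; rewrite eqr_int => /eqP; clear; case: j => j; lia.
have [k0|] := eqVneq k 0; first by rewrite kE k0.
rewrite neq_lt => /orP[kn|kp]; exfalso.
  have k1 : k%:~R <= -1 :> R by rewrite -[-1]/((-1)%:~R) ler_int; lia.
  have [c cI cE] : exists2 c, c \in `[0, t] & f c = - (1 / 2).
    by apply: IVT => //; rewrite f0 kE ge_min le_max; apply/andP; split; apply/orP; [right|left]; lra.
  apply: (half (f c)); [by right|apply: fk].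
  by move: cI; rewrite !in_itv/= => /andP[-> /le_trans]; apply.
have k1 : 1 <= k%:~R :> R by rewrite ler1z; lia.
have [c cI cE] : exists2 c, c \in `[0, t] & f c = 1 / 2.
  by apply: IVT => //; rewrite f0 kE ge_min le_max; apply/andP; split; apply/orP; [left|right]; lra.
apply: (half (f c)); [by left|apply: fk].
by move: cI; rewrite !in_itv/= => /andP[-> /le_trans]; apply.
Qed.

(** Two continuous angles of the same path differ by a continuous multiple of
    2 pi that vanishes at 0. *)
Lemma polar_form_unique (P : R -> R * R) r th r' th' :
  polar_form P r th -> polar_form P r' th' -> forall t, t \in `[0, 1] -> r t = r' t /\ th t = th' t.
Proof.
move=> [thc th0 PE] [thc' th0' PE'].
have p0 := pi_gt0 R.
have rE t : t \in `[0, 1] -> [/\ r t = r' t, cos (th t) = cos (th' t) & sin (th t) = sin (th' t)].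
  move=> tI; have [r0 E] := PE t tI; have [r0' E'] := PE' t tI.
  move: E'; rewrite E => -[Ec Es].
  have sq (u v : R) : (u * cos v) ^+ 2 + (u * sin v) ^+ 2 = u ^+ 2.
    by rewrite !exprMn -mulrDr cos2Dsin2 mulr1.
  have rr : r t = r' t.
    apply/eqP; rewrite -(@eqrXn2 _ 2%N) ?ltW//; apply/eqP.
    by rewrite -(sq (r t) (th t)) Ec Es sq.
  by split=> //; apply: (mulfI (lt0r_neq0 r0)); rewrite ?Ec ?Es rr.
move=> t tI; have [rr _ _] := rE t tI; split=> //.
pose f t := (th t - th' t) / (2 * pi).
suff : f t = 0.
  move=> /eqP; rewrite mulf_eq0 invr_eq0 [2 * pi == 0]gt_eqF ?orbF; last by lra.
  by rewrite subr_eq0 => /eqP.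
move: t tI {rr}; apply: continuous_int_valued.
- by move=> x; apply: cvgMl; apply: cvgB; [exact: thc|exact: thc'].
- by rewrite /f th0 th0' subrr mul0r.
- move=> t tI; have [_ cE sE] := rE t tI; have [k kE] := angle_mod_2pi cE sE; exists k.
  by rewrite /f kE mulrAC mulfV ?mul1r// gt_eqF//; lra.
Qed.

Lemma edge_coord_int e k : acute e -> edge_coord e k%:~R = k%:~R.
Proof. by move=> ae; rewrite -{1}(edge_time_int k ae) edge_timeK. Qed.

Lemma floor_edge_coord e y : acute e -> Num.floor (edge_coord e y) = Num.floor y.
Proof.
move=> ae; apply: floor_def; have /andP[f0 f1] := floor_itv y.
rewrite -(edge_coord_int _ ae) -[X in _ < X](edge_coord_int _ ae) edge_coord_lt// andbT.
by move: f0; rewrite le_eqVlt => /orP[/eqP->|/(edge_coord_lt ae)/ltW].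
Qed.

(** The chord from the angle 2 e k to 2 e (k + 1) is perpendicular to its
    bisector M = 2 e k + e, and the tangent of the angle between M and the point
    with parameter u is (2 u - 1) tan e. *)
Lemma chord_polar e y : acute e ->
  let k := (Num.floor y)%:~R in let u := y - k in let x := edge_coord e y in
  ((1 - u) * cos (2 * e * k) + u * cos (2 * e * (k + 1)) = edge_radius e (zigzag x) * cos (2 * e * x)) /\
  ((1 - u) * sin (2 * e * k) + u * sin (2 * e * (k + 1)) = edge_radius e (zigzag x) * sin (2 * e * x)).
Proof.
move=> ae k u x; have [e0 e1] := andP ae; have c0 := cos_acute ae.
pose eta := atan ((2 * u - 1) * tan e).
have xE : x - k - 1 / 2 = eta / (2 * e) by rewrite /x /edge_coord -/k -/u -/eta; ring.
have thE : 2 * e * x = 2 * e * k + e + eta.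
  have -> : x = k + 1 / 2 + eta / (2 * e) by rewrite -xE; ring.
  by field; rewrite gt_eqF.
have ceta : 0 < cos eta by apply: cos_gt0_pihalf; rewrite atan_gtNpi2 atan_ltpi2.
have rE : edge_radius e (zigzag x) = cos e / cos eta.
  rewrite /edge_radius /zigzag floor_edge_coord// -/k xE; congr (_ / _).
  have -> : e * (2 * `|eta / (2 * e)|) = `|eta|.
    by rewrite normrM normfV (@ger0_norm _ (2 * e)); [field; rewrite gt_eqF|lra].
  exact: cos_norm.
have sE : sin eta = (2 * u - 1) * (sin e / cos e) * cos eta.
  by rewrite -/(tan e) -(atanK (_ * tan e)) -/eta /tan divfK// gt_eqF.
have -> : 2 * e * k = (2 * e * k + e) - e by ring.
have -> : 2 * e * (k + 1) = (2 * e * k + e) + e by ring.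
rewrite thE rE; move: (2 * e * k + e) => M.
rewrite !cosB !cosD !sinB !sinD sE.
by split; field; rewrite !gt_eqF.
Qed.

End Polar.

Section Billiard.
Variables (R : realType) (s n m : nat).
Hypotheses (s_gt0 : (0 < s)%N) (n_gt0 : (0 < n)%N) (m_gt0 : (0 < m)%N).
Hypothesis coprime_sn : coprime s n.
Implicit Types (e x t phi : R) (a : nat).

Let s0 : 0 < s%:R :> R. Proof. by rewrite ltr0n. Qed.
Let n0 : 0 < n%:R :> R. Proof. by rewrite ltr0n. Qed.
Let m0 : 0 < m%:R :> R. Proof. by rewrite ltr0n. Qed.

(** Half the angle under which an edge of the chord path is seen. *)
Definition half_angle a : R := pi * s%:R / (n%:R * a%:R).

Definition billiard e phi t := strand s n m e (edge_time e) phi (edge_coord e (n%:R * t)).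

Lemma half_angle_acute a : (2 * s + 1 <= a * n)%N -> acute (half_angle a).
Proof.
move=> h; have a0 : (0 < a)%N by case: a h => //; rewrite mul0n addn1.
have a0' : 0 < a%:R :> R by rewrite ltr0n.
have p0 := pi_gt0 R; have na : 0 < n%:R * a%:R :> R by rewrite mulr_gt0.
rewrite /acute /half_angle divr_gt0 ?mulr_gt0//= ltr_pdivrMr//.
rewrite -mulrA ltr_pM2l// ltr_pdivlMl//.
have : (2 * s + 1)%:R <= (a * n)%:R :> R by rewrite ler_nat.
by rewrite natrD !natrM; lra.
Qed.

Lemma half_angleE a : (0 < a)%N -> 2 * half_angle a = s%:R * slice_angle R a / n%:R.
Proof.
move=> a0; have a0' : 0 < a%:R :> R by rewrite ltr0n.
by rewrite /half_angle /slice_angle; move: (pi : R) => p; field; rewrite !gt_eqF.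
Qed.

Lemma polar_form_billiard a : (0 < a)%N -> acute (half_angle a) ->
  let e := half_angle a in
  polar_form (@chord_path R s n a) (fun t => edge_radius e (zigzag (edge_coord e (n%:R * t))))
    (fun t => 2 * e * edge_coord e (n%:R * t)).
Proof.
move=> a0 ae e; split.
- apply: continuous_subspaceT => t; apply: cvgMr.
  apply: (@continuous_comp _ _ _ (fun t => n%:R * t)); last exact: edge_coord_continuous.
  by apply: cvgMr; exact: cvg_id.
- by rewrite mulr0 (edge_coord_int 0 ae) mulr0.
- move=> t _; split.
    by apply: edge_radius_gt0 => //; have := zigzag_ge0 (edge_coord e (n%:R * t));
      have := zigzag_le1 (edge_coord e (n%:R * t)); lra.
  have [] := chord_polar (n%:R * t) ae; rewrite -/e => <- <-.
  have vE k : k%:~R * s%:R * slice_angle R a / n%:R = 2 * e * k%:~R.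
    by rewrite /e half_angleE//; ring.
  by rewrite /chord_path /path_vertex /= !vE intrD.
Qed.

Lemma billiard_turning a x : (0 < a)%N ->
  2 * pi * (2 * half_angle a * x) / slice_angle R a = turning s n x.
Proof.
move=> a0; have a0' : 0 < a%:R :> R by rewrite ltr0n.
have := pi_gt0 R; rewrite /half_angle /slice_angle /turning.
by move: (pi : R) => p p0; field; rewrite !gt_eqF.
Qed.

Lemma billiard_height e phi t : acute e ->
  height n m (edge_time e) phi (edge_coord e (n%:R * t)) = zigzag (m%:R * t + phi).
Proof. by move=> ae; rewrite /height edge_coordK//; congr zigzag; field; rewrite gt_eqF. Qed.

Lemma strand_periodic e phi x (k : int) :
  strand s n m e (edge_time e) phi (x + n%:R * k%:~R) = strand s n m e (edge_time e) phi x.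
Proof.
rewrite /strand height_periodic//; last by move=> *; exact: edge_timeDz.
by have [-> ->] := planar_periodic s n_gt0 e x k.
Qed.

Lemma edge_coordDn e y (k : int) : acute e ->
  edge_coord e (y + n%:R * k%:~R) = edge_coord e y + n%:R * k%:~R.
Proof. by move=> ae; rewrite -[n%:R]/(n%:Z%:~R) -intrM edge_coordDz. Qed.

Lemma billiard_periodic e phi t (k : int) : acute e -> billiard e phi (t + k%:~R) = billiard e phi t.
Proof. by move=> ae; rewrite /billiard mulrDr edge_coordDn// strand_periodic. Qed.

Lemma slice_curve_billiard a phi : (0 < a)%N -> acute (half_angle a) ->
  slice_curve s n m a phi (billiard (half_angle a) phi).
Proof.
move=> a0 ae; split; first by move=> t; rewrite -[1]/(1%:~R) billiard_periodic.
exists (fun t => edge_radius (half_angle a) (zigzag (edge_coord (half_angle a) (n%:R * t)))),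
  (fun t => 2 * half_angle a * edge_coord (half_angle a) (n%:R * t)).
split; first exact: polar_form_billiard.
by move=> t _ /=; rewrite /billiard /strand billiard_height// billiard_turning.
Qed.

(** The angle of the chord path is unique, and periodicity determines the curve
    outside the unit interval. *)
Lemma slice_curve_unique a phi K : (0 < a)%N -> acute (half_angle a) ->
  slice_curve s n m a phi K -> K = billiard (half_angle a) phi.
Proof.
move=> a0 ae [K1 [r [th [pf KE]]]].
have Kz t (k : int) : K (t + k%:~R) = K t.
  have Kn u i : K (u + i%:R) = K u by elim: i => [|i IH]; rewrite ?addr0// -addn1 natrD addrA K1.
  by case: (intP k) => [|i|i]; [rewrite addr0|exact: Kn|rewrite -(Kn _ i.+1) mulrNz subrK].
apply/funext => t; rewrite -(subrK (Num.floor t)%:~R t) Kz billiard_periodic//.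
have tI : t - (Num.floor t)%:~R \in `[0, 1] by rewrite in_itv/=; have := floor_bounds t; lra.
have [rE thE] := polar_form_unique pf (polar_form_billiard a0 ae) tI.
by rewrite KE//= rE thE /billiard /strand billiard_height// billiard_turning.
Qed.

Lemma billiard_inj e phi t t' : acute e -> admissible s n m (edge_time e) -> generic s n m phi ->
  billiard e phi t = billiard e phi t' -> exists k : int, t - t' = k%:~R.
Proof.
move=> ae aT gphi E; have [k kE] := strand_inj s_gt0 n_gt0 m_gt0 coprime_sn ae aT gphi E.
exists k; apply: (@mulfI _ n%:R); first by rewrite gt_eqF.
have xE : edge_coord e (n%:R * t) = edge_coord e (n%:R * t') + n%:R * k%:~R by rewrite -kE; ring.
have := congr1 (edge_time e) xE; rewrite -edge_coordDn// !edge_coordK// mulrBr => ->; ring.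
Qed.

Lemma billiard_continuous e phi : acute e -> continuous (billiard e phi).
Proof.
move=> ae t; apply: (@continuous_comp _ _ _ (fun t => edge_coord e (n%:R * t))).
  apply: (@continuous_comp _ _ _ (fun t => n%:R * t)); last exact: edge_coord_continuous.
  by apply: cvgMr; exact: cvg_id.
have [Xc Yc] := planar_continuous s n ae.
by apply: continuous_triple => //; apply: height_continuous => //; exact: edge_time_continuous.
Qed.

Lemma billiard_knot e phi : acute e -> admissible s n m (edge_time e) -> generic s n m phi ->
  is_knot (billiard e phi).
Proof.
move=> ae aT gphi; split.
- exact: billiard_continuous.
- by move=> t; rewrite -[1]/(1%:~R) billiard_periodic.
- move=> t t'; rewrite !in_itv/= => tI tI' /(billiard_inj ae aT gphi)[k kE].
  have : `|k%:~R| < 1 :> R by rewrite -kE ltr_norml; lra.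
  rewrite -intr_norm ltrz1 => k1; have k0 : k = 0 by lia.
  by move: kE; rewrite k0 => /eqP; rewrite subr_eq0 => /eqP.
Qed.

(** If m k / n + 2 phi is an integer and s > 1, then the points (k - n/s)/2 and
    (k + n/s)/2 form a crossing at which both strands have the same height. *)
Lemma knot_generic e phi : acute e -> is_knot (billiard e phi) -> generic s n m phi.
Proof.
move=> ae [_ _ Kinj] s1 k l; apply/eqP => kl.
have ns : n%:R / s%:R * s%:R = n%:R :> R by rewrite divfK// gt_eqF.
pose x : R := (k%:~R - n%:R / s%:R) / 2; pose y : R := (k%:~R + n%:R / s%:R) / 2.
have xy : x + y = k%:~R by rewrite /x /y; field; rewrite gt_eqF.
have yx : y - x = n%:R / s%:R by rewrite /x /y; field; rewrite gt_eqF.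
have E : strand s n m e (edge_time e) phi x = strand s n m e (edge_time e) phi y.
  have tE : turning s n y = turning s n x + 2 * pi * 1%:~R.
    rewrite /turning -(subrK x y) yx; move: (pi : R) => p; field; rewrite !gt_eqF//.
  rewrite /strand /planar_x /planar_y tE cosD2piz sinD2piz (zigzag_even xy).
  congr (_, _, _); apply: (@zigzag_even _ _ _ l); rewrite -kl.
  have -> : y = - x + k%:~R by rewrite -xy; ring.
  by rewrite edge_timeDz edge_timeN//; field; rewrite gt_eqF.
pose t := edge_time e x / n%:R; pose t' := edge_time e y / n%:R.
have nt u : n%:R * (edge_time e u / n%:R) = edge_time e u by rewrite mulrC divfK// gt_eqF.
have Bt : billiard e phi t = billiard e phi t'.
  by rewrite /billiard /t /t' !nt !edge_timeK.
have fl (u : R) : u - (Num.floor u)%:~R \in `[0, 1[ by rewrite in_itv/=; have := floor_bounds u; lra.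
have := Kinj (t - (Num.floor t)%:~R) (t' - (Num.floor t')%:~R) (fl t) (fl t').
rewrite -!intrN !billiard_periodic// => /(_ Bt) tt.
pose j := Num.floor t' - Num.floor t; have tj : t' = t + j%:~R.
  by move: tt; rewrite !intrN /j intrB => h; lra.
have : edge_time e y = edge_time e (x + n%:R * j%:~R).
  rewrite -[n%:R * _]/(n%:Z%:~R * _) -intrM edge_timeDz intrM -[n%:Z%:~R]/(n%:R) -(nt y) -/t' tj -(nt x) -/t.
  by ring.
move/(edge_time_inj ae) => yE.
have : n%:R * (s%:Z * j)%:~R = n%:R * 1 :> R.
  rewrite mulr1 -{2}ns -yx yE intrM; ring.
move/(mulfI (lt0r_neq0 n0))/eqP; rewrite -[1]/(1%:~R) eqr_int => /eqP.
move/(congr1 absz); rewrite abszM /= => /eqP; rewrite muln_eq1 => /andP[/eqP s1' _].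
by rewrite s1' in s1.
Qed.

End Billiard.

(** * Phases *)

Section Phases.
Variables (R : realType) (s n m : nat).
Hypotheses (s_gt0 : (0 < s)%N) (n_gt0 : (0 < n)%N) (m_gt0 : (0 < m)%N).
Hypothesis coprime_sn : coprime s n.
Implicit Types (e x t phi : R) (a : nat) (k p q : int).

Let s0 : 0 < s%:R :> R. Proof. by rewrite ltr0n. Qed.
Let n0 : 0 < n%:R :> R. Proof. by rewrite ltr0n. Qed.
Let m0 : 0 < m%:R :> R. Proof. by rewrite ltr0n. Qed.

Local Notation curve := (@billiard R s n m).
Local Notation generic := (@generic R s n m).

Lemma circle_reparam_id : circle_reparam (fun t : R => t).
Proof. by split=> // t; exact: cvg_id. Qed.

(** First the heights change at fixed projection, then the distances to the
    axis. The curves are parametrized by time, so the passage from one slice to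
    the other reparametrizes the circle. *)
Lemma knot_equivalent_angle e e' phi phi' : acute e -> acute e' ->
  admissible s n m (edge_time e) -> admissible s n m (edge_time e') ->
  (forall l, 0 <= l <= 1 -> generic ((1 - l) * phi + l * phi')) ->
  knot_equivalent (curve e phi) (curve e' phi').
Proof.
move=> ae ae' aT aT' gen.
pose K t := strand s n m e (edge_time e') phi' (edge_coord e (n%:R * t)).
apply: (@knot_equivalent_trans _ _ K).
  pose L := Num.max (max_slope e) (max_slope e').
  have eL : max_slope e <= L by rewrite le_max lexx.
  have eL' : max_slope e' <= L by rewrite le_max lexx orbT.
  have L0 : 0 <= L.
    apply: le_trans eL; rewrite /max_slope mulr_ge0 ?invr_ge0 ?sqr_ge0//.
    exact: ltW (min_slope_gt0 ae).
  have [||H Hiso HE] := height_isotopy s_gt0 n_gt0 m_gt0 coprime_sn ae aT aT'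
    (edge_time_continuous ae) (edge_time_continuous ae') L0 _ _
    (fun x => @edge_time_shift_sign _ e e' x ae ae') gen.
  - by move=> x y; apply: le_trans (edge_time_lipschitz x y ae) _; rewrite ler_wpM2r.
  - by move=> x y; apply: le_trans (edge_time_lipschitz x y ae') _; rewrite ler_wpM2r.
  by exists H, id; split=> //; [exact: circle_reparam_id|move=> t; exact: HE].
have [H Hiso HE] := radial_isotopy ae ae'.
exists H, (fun t => edge_time e' (edge_coord e (n%:R * t)) / n%:R); split=> //.
- split.
  + move=> t; apply: cvgMl; apply: (@continuous_comp _ _ _ (fun t => edge_coord e (n%:R * t))).
      apply: (@continuous_comp _ _ _ (fun t => n%:R * t)); last exact: edge_coord_continuous.
      by apply: cvgMr; exact: cvg_id.
    exact: edge_time_continuous.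
  + move=> t u tu; rewrite ltr_pM2r ?invr_gt0//.
    by apply: edge_time_lt => //; apply: edge_coord_lt => //; rewrite ltr_pM2l.
  + move=> t; have -> : n%:R * (t + 1) = n%:R * t + n%:Z%:~R by rewrite mulrDr mulr1.
    by rewrite edge_coordDz// edge_timeDz mulrDl divff// gt_eqF.
- move=> t; rewrite /K /billiard [n%:R * (_ / _)]mulrC divfK ?gt_eqF// edge_timeK//.
  rewrite /strand /planar_x /planar_y HE// ?cos2Dsin2//.
  by rewrite zigzag_ge0 zigzag_le1.
Qed.

(** The symmetry of the projection that maps the edge coordinate x to x + p. *)
Lemma knot_equivalent_shift e phi p : acute e ->
  knot_equivalent (curve e (phi + m%:R * p%:~R / n%:R)) (curve e phi).
Proof.
move=> ae; exists (fun l => rotate_z (l * (2 * pi * (s%:R * p%:~R / n%:R)))), (fun t => t + p%:~R / n%:R).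
split; first exact: rotate_z_isotopy.
  split; first by move=> t; apply: cvgD; [exact: cvg_id|exact: cvg_cst].
    by move=> t u tu; rewrite ltrD2r.
  by move=> t; rewrite addrAC.
move=> t; rewrite mul1r /billiard.
have -> : n%:R * (t + p%:~R / n%:R) = n%:R * t + p%:~R by field; rewrite gt_eqF.
rewrite edge_coordDz//; move: (edge_coord e _) => x.
have tE : turning s n (x + p%:~R) = turning s n x + 2 * pi * (s%:R * p%:~R / n%:R) :> R.
  by rewrite /turning; ring.
rewrite /strand /rotate_z /planar_x /planar_y /height /= tE cosD sinD zigzagDz edge_timeDz.
by congr (_, _, zigzag _); ring.
Qed.

Lemma billiard_phaseDz e phi k : curve e (phi + k%:~R) = curve e phi.
Proof.
apply/funext => t; rewrite /billiard /strand /height; congr (_, _, _).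
by rewrite addrA zigzagDz.
Qed.

Lemma edge_coordN e y : acute e -> edge_coord e (- y) = - edge_coord e y.
Proof. by move=> ae; apply: (edge_time_inj ae); rewrite edge_timeN// !edge_coordK. Qed.

(** Reversing the time reflects the projection in the x-axis; a half-turn about
    this axis turns that reflection into the mirror image in the plane z = 0. *)
Lemma knot_equivalent_flip e phi : acute e ->
  knot_equivalent (curve e (- phi)) (reverse (mirror (curve e phi))).
Proof.
move=> ae; exists (fun l => rotate_x (l * pi)), (fun t => t); split.
- exact: rotate_x_isotopy.
- exact: circle_reparam_id.
move=> t; rewrite mul1r /reverse /mirror /billiard /rotate_x cospi sinpi mulrN edge_coordN//.
move: (edge_coord e _) => x; rewrite /strand /planar_x /planar_y /height /=.
have tE : turning s n (- x) = - turning s n x :> R by rewrite /turning; ring.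
rewrite tE cosN sinN zigzagN edge_timeN//.
have -> : zigzag (m%:R * - edge_time e x / n%:R + phi) = zigzag (m%:R * edge_time e x / n%:R - phi).
  by rewrite -zigzagN; congr zigzag; ring.
by congr (_, _, _); ring.
Qed.

(** The critical phases, those that are not generic for s > 1, are the multiples
    of 1 / (2 n'), because the numbers m k / n + j form the lattice of the
    multiples of 1 / n'. *)
Let n' := (n %/ gcdn m n)%N.
Let n'E : n'%:R * (gcdn m n)%:R = n%:R :> R.
Proof. by rewrite -natrM divnK// dvdn_gcdr. Qed.
Let g0 : 0 < (gcdn m n)%:R :> R. Proof. by rewrite ltr0n gcdn_gt0 m_gt0. Qed.
Let n'0 : 0 < n'%:R :> R.
Proof. by rewrite -(@pmulr_lgt0 _ (gcdn m n)%:R) ?n'E. Qed.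

Lemma bezout_phase q : exists p k, q%:~R / n'%:R = m%:R * p%:~R / n%:R + k%:~R :> R.
Proof.
have [u [v uv]] := Bezoutz m n; exists (q * u), (q * v).
have : (u * m%:Z + v * n%:Z)%:~R = (gcdn m n)%:R :> R by rewrite uv.
rewrite intrD !intrM => E.
have n'n : n'%:R^-1 = (gcdn m n)%:R / n%:R :> R by rewrite -n'E; field; rewrite !gt_eqF.
by rewrite n'n -E; field; rewrite gt_eqF.
Qed.

Lemma generic_cell phi : generic phi <->
  ((1 < s)%N -> (Num.floor (2 * n'%:R * phi))%:~R != 2 * n'%:R * phi).
Proof.
split=> gphi s1.
  apply/eqP => E; set q := Num.floor _ in E.
  have [p [k pk]] := bezout_phase q.
  have /eqP[] := gphi s1 (- p) k.
  have -> : 2 * phi = q%:~R / n'%:R by rewrite E; field; rewrite gt_eqF.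
  by rewrite pk intrN; ring.
move=> k j; apply/eqP => E; have /eqP[] := gphi s1.
pose m' := (m %/ gcdn m n)%N.
have m'E : m'%:R * (gcdn m n)%:R = m%:R :> R by rewrite -natrM divnK// dvdn_gcdl.
have -> : 2 * n'%:R * phi = (n'%:Z * j - m'%:Z * k)%:~R.
  rewrite intrB !intrM -E -m'E -n'E; field; rewrite !gt_eqF//.
by rewrite intrKfloor.
Qed.

Lemma generic_mix phi phi' : generic phi -> generic phi' ->
  ((1 < s)%N -> Num.floor (2 * n'%:R * phi) = Num.floor (2 * n'%:R * phi')) ->
  forall l, 0 <= l <= 1 -> generic ((1 - l) * phi + l * phi').
Proof.
move=> /generic_cell gphi /generic_cell gphi' fE l /andP[l0 l1]; apply/generic_cell => s1.
have := gphi s1; have := gphi' s1; have := floor_bounds (2 * n'%:R * phi).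
have := floor_bounds (2 * n'%:R * phi'); rewrite -(fE s1).
have -> : 2 * n'%:R * ((1 - l) * phi + l * phi') =
  (1 - l) * (2 * n'%:R * phi) + l * (2 * n'%:R * phi') by ring.
move: (2 * n'%:R * phi) (2 * n'%:R * phi') => u v.
set k := Num.floor u => /andP[v0 v1] /andP[u0 u1] vk uk.
have {}v0 : k%:~R < v by rewrite lt_neqAle vk.
have {}u0 : k%:~R < u by rewrite lt_neqAle uk.
have [->|ln0] := eqVneq l 0; first by rewrite subr0 mul1r mul0r addr0.
have {}l0 : 0 < l by rewrite lt_neqAle eq_sym ln0.
have lo : k%:~R < (1 - l) * u + l * v.
  have h1 : 0 <= (1 - l) * (u - k%:~R) by rewrite mulr_ge0//; lra.
  have h2 : 0 < l * (v - k%:~R) by rewrite mulr_gt0//; lra.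
  lra.
have hi : (1 - l) * u + l * v < (k + 1)%:~R.
  have h1 : 0 <= (1 - l) * (k%:~R + 1 - u) by rewrite mulr_ge0//; lra.
  have h2 : 0 < l * (k%:~R + 1 - v) by rewrite mulr_gt0//; lra.
  by rewrite intrD; lra.
by rewrite (@floor_def _ _ k) ?lt_eqF// hi ltW.
Qed.

Lemma int_parity (d : int) : exists q, d = 2 * q \/ d = 2 * q + 1.
Proof.
exists (d %/ 2)%Z; have := divz_eq d 2; have := @modz_ge0 d 2 isT; have := @ltz_pmod d 2 isT.
move: (d %/ 2)%Z (d %% 2)%Z => q r r2 r0 ->.
have [->|->] : r = 0 \/ r = 1 by lia.
  by left; rewrite addr0 mulrC.
by right; rewrite mulrC.
Qed.

(** Let N and N' be the numbers of the cells of phi and phi' between critical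
    phases. Rotations shift cells by even numbers. If N - N' is even, then
    phi' can be moved to the cell of phi. If it is odd, then the flip replaces
    N' by - N' - 1, which has the parity of N. *)
Lemma knot_eq_billiard e e' phi phi' : acute e -> acute e' ->
  admissible s n m (edge_time e) -> admissible s n m (edge_time e') ->
  generic phi -> generic phi' -> knot_eq (curve e phi) (curve e' phi').
Proof.
move=> ae ae' aT aT' gphi gphi'.
have [s1|s1] := leqP s 1.
  apply: Or41; apply: knot_equivalent_angle => // l _; apply/generic_cell.
  by rewrite ltnNge s1.
pose N := Num.floor (2 * n'%:R * phi); pose N' := Num.floor (2 * n'%:R * phi').
have [k'0 k'1] := andP (floor_bounds (2 * n'%:R * phi')).
have k'n : N'%:~R != 2 * n'%:R * phi' by have /generic_cell := gphi'; exact.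
have {}k'0 : N'%:~R < 2 * n'%:R * phi' by rewrite lt_neqAle k'n.
(* A rotation moves psi by q / n' into the cell of phi. *)
have move psi q : N%:~R < 2 * n'%:R * psi + 2 * q%:~R < N%:~R + 1 ->
    knot_equivalent (curve e phi) (curve e' psi).
  have [p [k pk]] := bezout_phase q => psiI.
  apply: (@knot_equivalent_trans _ _ (curve e' (psi + m%:R * p%:~R / n%:R + k%:~R))); last first.
    by rewrite billiard_phaseDz; exact: knot_equivalent_shift.
  have E : 2 * n'%:R * (psi + m%:R * p%:~R / n%:R + k%:~R) = 2 * n'%:R * psi + 2 * q%:~R.
    by rewrite -addrA -pk; field; rewrite gt_eqF.
  have fE : Num.floor (2 * n'%:R * (psi + m%:R * p%:~R / n%:R + k%:~R)) = N.
    by apply: floor_def; rewrite E intrD; lra.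
  apply: knot_equivalent_angle => //; apply: generic_mix => //.
  by apply/generic_cell => _; rewrite fE E lt_eqF//; lra.
have [q [qE|qE]] := int_parity (N - N').
  apply: Or41; apply: (move _ q).
  have : N%:~R - N'%:~R = 2 * q%:~R :> R by rewrite -intrB qE intrM.
  by lra.
apply: Or44; apply: (@knot_equivalent_trans _ _ (curve e' (- phi'))); last exact: knot_equivalent_flip.
apply: (move _ (q + N' + 1)).
have : N%:~R - N'%:~R = 2 * q%:~R + 1 :> R by rewrite -intrB qE intrD intrM.
by rewrite mulrN !intrD; lra.
Qed.

(** Multiplying by 2 n turns the equation m k / n + 2 phi = j into an odd number
    being even. *)
Lemma generic_exists : generic (1 / (4 * n%:R)).
Proof.
move=> _ k j; apply/eqP => E.
have : (2 * m%:Z * k + 1)%:~R = (2 * n%:Z * j)%:~R :> R.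
  rewrite intrD !intrM -E; field; rewrite gt_eqF//.
move/eqP; rewrite eqr_int => /eqP; lia.
Qed.

(** The half angle tends to 0, hence so does the bound of time_shift_bound. *)
Lemma small_half_angle : exists a0 : nat, forall a, (a0 <= a)%N ->
  m%:R * s%:R * (1 - cos (half_angle R s n a) ^+ 2) < n%:R.
Proof.
pose d : R := n%:R / (2 * m%:R * s%:R); have d0 : 0 < d by rewrite divr_gt0// !mulr_gt0.
have := @continuous_cos R 0; move/cvgrPdist_lt/(_ d d0)/nbhs_ballP => [r r0 rd].
have p0 := pi_gt0 R; have b0 : 0 <= pi * s%:R / (n%:R * r) :> R.
  by apply: divr_ge0; apply: mulr_ge0 => //; exact: ltW.
exists (Num.bound (pi * s%:R / (n%:R * r))).+1 => a a0.
have aR : pi * s%:R / (n%:R * r) < a%:R :> R.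
  by apply: lt_le_trans (archi_boundP b0) _; rewrite ler_nat ltnW.
have a0' : 0 < a%:R :> R := le_lt_trans b0 aR.
have h0 : 0 < half_angle R s n a by apply: divr_gt0; apply: mulr_gt0.
have hr : half_angle R s n a < r.
  move: aR; rewrite /half_angle ltr_pdivrMr ?mulr_gt0// ltr_pdivrMr ?mulr_gt0//; lra.
have := rd (half_angle R s n a); rewrite /ball /= sub0r normrN gtr0_norm// => /(_ hr).
rewrite cos0 ltr_norml => /andP[_ cd].
have c1 := cos_le1 (half_angle R s n a); have c2 := cos_geN1 (half_angle R s n a).
move: (cos _) cd c1 c2 => c cd c1 c2.
have : 1 - c ^+ 2 <= 2 * (1 - c) by nra.
rewrite -(ler_pM2l (mulr_gt0 m0 s0)) => /le_lt_trans; apply.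
by move: cd; rewrite /d ltr_pdivlMr ?mulr_gt0//; lra.
Qed.

End Phases.

Theorem theorem4p4p1 (R : realType) (s n m : nat)
    (s_gt0 : (0 < s)%N) (n_gt0 : (0 < n)%N) (m_gt0 : (0 < m)%N)
    (coprime_sn : coprime s n) :
  exists a0 : nat,
    [/\ (1 <= a0)%N, (2 * s + 1 <= a0 * n)%N &
    forall a : nat, (a0 <= a)%N ->
      (exists K : R -> R * R * R, factor_knot s n m a K) /\
      (forall K0 K : R -> R * R * R,
         factor_knot s n m a0 K0 -> factor_knot s n m a K -> knot_eq K0 K)].
Proof.
have [b bsmall] := @small_half_angle R s n m s_gt0 n_gt0 m_gt0.
pose a0 := (2 * s + 1 + b)%N.
have big a : (a0 <= a)%N -> [/\ (0 < a)%N, (2 * s + 1 <= a * n)%N,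
    acute (half_angle R s n a) & admissible s n m (edge_time (half_angle R s n a))].
  rewrite /a0 => a0a; have an : (2 * s + 1 <= a * n)%N by nia.
  have ae : acute (half_angle R s n a) by exact: half_angle_acute.
  split=> //; first by lia.
  by apply: edge_time_admissible => //; apply: bsmall; lia.
have model a : (a0 <= a)%N -> forall K, factor_knot s n m a K ->
    exists2 phi, generic s n m phi & K = billiard s n m (half_angle R s n a) phi.
  move=> /big[a_gt0 _ ae _] K [_ _ Kknot [phi _ Kphi]].
  have KE := slice_curve_unique n_gt0 a_gt0 ae Kphi.
  by exists phi => //; apply: (knot_generic s_gt0 n_gt0 ae); rewrite -KE.
have [a0_gt0 a0n ae0 aT0] := big a0 (leqnn _).
exists a0; split=> // a a0a; have [a_gt0 an ae aT] := big a a0a; split.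
  exists (billiard s n m (half_angle R s n a) (1 / (4 * n%:R))); split=> //.
    by apply: billiard_knot => //; exact: generic_exists.
  exists (1 / (4 * n%:R)); last exact: slice_curve_billiard.
  have n1 : 1 <= n%:R :> R by rewrite ler1n.
  rewrite in_itv/= divr_ge0 ?mulr_ge0//= ler_pdivrMr ?mul1r; lra.
move=> K0 K /(model _ (leqnn _))[phi0 g0 ->] /(model _ a0a)[phi g ->].
exact: knot_eq_billiard.
Qed.
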